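(* Let $X$ be a compact Kähler surface with Kähler form $\omega$, let $(E,h)$ be a Hermitian vector bundle of rank two on $X$ with $c_1(E)=0$, and let $\{(A_n,\phi_n)\}_{n\in\mathbb{N}}$ be a sequence of solutions to Simpson's equations. Put $r_n:=\|\phi_n\|_{L^2}>0$, assume that $\{r_n\}$ has no bounded subsequence, and put $\varphi_n:=\phi_n/r_n$. Let $Z$ be the singular set of this sequence, i.e. the zero set of the limit function $|\hat\varphi_\diamond|$ given by Taubes' analysis, outside which $\{(A_n,\varphi_n)\}$ has an $L^2_1$ convergent subsequence after suitable gauge transformations, except for bubbling at a finite set of points of $X$. Then $Z$ has the structure of an analytic subvariety of $X$.
   Context: $\Omega^1_X$ is the holomorphic cotangent bundle of $X$, and $\Lambda$ applied to forms is the adjoint of $\wedge\,\omega$. $\mathcal{A}_{(E,h)}$ is the space of $h$-unitary connections on $E$, and $\mathfrak{u}(E)$ is the bundle of skew-Hermitian endomorphisms of $E$. $\Omega^{1,0}(\mathfrak{u}(E))$ denotes smooth $(1,0)$-forms with values in $\mathfrak{u}(E)\otimes\mathbb{C}=\mathrm{End}(E)$, and $\phi^*$ is the $(0,1)$-form that is the Hermitian adjoint of $\phi$. $[\alpha\wedge\beta]$ combines the wedge product of forms with the commutator of endomorphisms. Simpson's equations for $(A,\phi)\in\mathcal{A}_{(E,h)}\times\Omega^{1,0}(\mathfrak{u}(E))$ are $$\bar\partial_A\phi=0,\qquad [\phi\wedge\phi]=0,\qquad F_A^{0,2}=0,\qquad \Lambda\bigl(F_A^{1,1}+2[\phi\wedge\phi^*]\bigr)=0.$$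 Taubes' analysis provides the following for such a sequence: - a subsequence $\Xi\subset\mathbb{N}$ and a finite set $\Theta\subset X$; - a function $|\hat\varphi_\diamond|$, the $L^2_1$ limit of $\{|\varphi_i|\}_{i\in\Xi}$, which is continuous on $X\setminus\Theta$, with $|\varphi_i|\to|\hat\varphi_\diamond|$ in $C^0$ on compact subsets of $X\setminus\Theta$; - the zero set $Z$ of $|\hat\varphi_\diamond|$, which is closed and nowhere dense; - a real line bundle $\mathcal{J}$ on $X\setminus(\Theta\cup Z)$, a section $\mu$ of $\mathcal{J}\otimes\Omega^1_X$ there, a Hermitian vector bundle $(E_\Delta,h_\Delta)$ on $X\setminus(\Theta\cup Z)$ with a connection $A_\Delta$, an isometric bundle homomorphism $\tau_\Delta:\mathcal{J}\to\mathfrak{u}(E_\Delta)$, and isomorphisms $g_i:E_\Delta\to E|_{X\setminus(\Theta\cup Z)}$ ($i\in\Xi$), such that $g_i^*\varphi_i\to\tau_\Delta\circ\mu$ in $L^2_1$ on compact subsets of $X\setminus(\Theta\cup Z)$ and in the $C^0$ topology on $X\setminus\Theta$, and $g_i^*A_i\to A_\Delta$ in $L^2_1$ on compact subsets of $X\setminus(\Theta\cup Z)$. *)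

(* Defs.v *)
From HB Require Import structures.
From mathcomp Require Import all_boot all_order all_algebra.
From mathcomp Require Import all_classical all_reals all_analysis.
From mathcomp Require Import complex.
Set Implicit Arguments.
Unset Strict Implicit.
Unset Printing Implicit Defensive.
Import Order.TTheory GRing.Theory Num.Theory numFieldNormedType.Exports.
Local Open Scope classical_set_scope.
Local Open Scope ring_scope.

(** C^2 is carried by R^4 in the real coordinates ((x_1, y_1), (x_2, y_2)) with
    z_j = x_j + i y_j.  Complex-valued functions are differentiated through
    their real and imaginary parts, which avoids putting a topology on R[i].
    All derivatives are total functions and
    are only meaningful where the function is differentiable. *)

Notation C2 R := ((R * R) * (R * R))%type.

(* The real directions: (j, false) is d/dx_j and (j, true) is d/dy_j. *)
Notation dir := ('I_2 * bool)%type.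

Section Calculus.
Context {R : realType}.
Local Notation C := R[i].

Definition zcoord (j : 'I_2) (p : C2 R) : C :=
  if j == 0 then Complex p.1.1 p.1.2 else Complex p.2.1 p.2.2.

Definition rcoord (k : dir) (p : C2 R) : R :=
  if k.2 then complex.Im (zcoord k.1 p) else complex.Re (zcoord k.1 p).

Definition dirv (k : dir) : C2 R :=
  let u : R * R := if k.2 then (0, 1) else (1, 0) in
  if k.1 == 0 then (u, (0, 0)) else ((0, 0), u).

Definition pd (k : dir) (f : C2 R -> R) (p : C2 R) : R := 'D_(dirv k) f p.

Definition cpd (k : dir) (f : C2 R -> C) (p : C2 R) : C :=
  Complex (pd k (fun q => complex.Re (f q)) p)
          (pd k (fun q => complex.Im (f q)) p).

Definition dz (j : 'I_2) (f : C2 R -> C) (p : C2 R) : C :=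
  (cpd (j, false) f p - 'i%C * cpd (j, true) f p) / 2.

Definition dzbar (j : 'I_2) (f : C2 R -> C) (p : C2 R) : C :=
  (cpd (j, false) f p + 'i%C * cpd (j, true) f p) / 2.

Definition smooth_on (O : set (C2 R)) (f : C2 R -> R) : Prop :=
  forall (s : seq dir) p, O p ->
    {for p, continuous (foldr pd f s)} /\
    forall k, derivable (foldr pd f s) p (dirv k).

Definition csmooth_on (O : set (C2 R)) (f : C2 R -> C) : Prop :=
  smooth_on O (fun p => complex.Re (f p)) /\
  smooth_on O (fun p => complex.Im (f p)).

Definition holomorphic_on (O : set (C2 R)) (f : C2 R -> C) : Prop :=
  csmooth_on O f /\ forall p, O p -> forall j, dzbar j f p = 0.

Definition leb2 : set (measurableTypeR R * measurableTypeR R)%type -> \bar R :=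
  (@lebesgue_measure R \x @lebesgue_measure R)%E.

HB.instance Definition _ := Measure.on leb2.

Let leb2_sigma_finite : sigma_finite setT leb2.
Proof.
have /sigma_finiteP[F [TF ndF Foo]] := sigma_finiteT (@lebesgue_measure R).
exists (fun n => F n `*` F n).
  rewrite -setXTT TF predeqE => -[x y]; split.
    move=> [/= [n _ Fnx] [k _ Fky]]; exists (maxn n k) => //; split.
    - by move: x Fnx; exact/subsetPset/ndF/leq_maxl.
    - by move: y Fky; exact/subsetPset/ndF/leq_maxr.
  by move=> [n _ []/= ? ?]; split; exists n.
move=> k; have [? ?] := Foo k.
split; first exact: measurableX.
by rewrite [leb2 _]product_measure1E// lte_mul_pinfty// ge0_fin_numE.
Qed.

HB.instance Definition _ :=
  Measure_isSigmaFinite.Build _ _ _ leb2 leb2_sigma_finite.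

Definition leb4 : {measure set _ -> \bar R} := (leb2 \x leb2)%E.

Definition loc_integrable (O : set (C2 R)) (f : C2 R -> R) : Prop :=
  forall K, compact K -> K `<=` O -> leb4.-integrable K (EFin \o f).

Definition test_function (O : set (C2 R)) (psi : C2 R -> R) : Prop :=
  smooth_on setT psi /\
  exists K, [/\ compact K, K `<=` O & forall p, ~ K p -> psi p = 0].

Definition weak_pd (O : set (C2 R)) (k : dir) (f g : C2 R -> R) : Prop :=
  [/\ loc_integrable O f, loc_integrable O g &
    forall psi, test_function O psi ->
      (\int[leb4]_(p in O) (f p * pd k psi p))%R =
      - (\int[leb4]_(p in O) (g p * psi p))%R].

(* [f_ n --> f] in L^2_1 on compact subsets of O: the differences have weak
   first derivatives [w], and they and [w] tend to 0 in L^2 on compacta. *)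
Definition L21_cvg (O : set (C2 R)) (f_ : nat -> C2 R -> R) (f : C2 R -> R) :
    Prop :=
  exists w : nat -> dir -> C2 R -> R,
    (forall n k, weak_pd O k (fun p => f_ n p - f p) (w n k)) /\
    forall K, compact K -> K `<=` O ->
      ((fun n => (\int[leb4]_(p in K) ((f_ n p - f p) ^+ 2)%:E)%E) @ \oo
         --> (0 : \bar R)) /\
      forall k, (fun n => (\int[leb4]_(p in K) (w n k p ^+ 2)%:E)%E) @ \oo
         --> (0 : \bar R).

Definition cL21_cvg (O : set (C2 R)) (f_ : nat -> C2 R -> C) (f : C2 R -> C) :
    Prop :=
  L21_cvg O (fun n p => complex.Re (f_ n p)) (fun p => complex.Re (f p)) /\
  L21_cvg O (fun n p => complex.Im (f_ n p)) (fun p => complex.Im (f p)).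

End Calculus.

Section LinearAlgebra.
Context {R : realType}.
Local Notation C := R[i].

Definition adj m n (M : 'M[C]_(m, n)) : 'M[C]_(n, m) := map_mx conjc M^T.

Definition positive_hermitian n (M : 'M[C]_n) : Prop :=
  adj M = M /\
  forall v : 'cV[C]_n, v != 0 -> 0 < (adj v *m M *m v) 0 0.

Definition comm n (M N : 'M[C]_n) : 'M[C]_n := M *m N - N *m M.

(* The adjoint of M for the inner product <s, t> = adj t *m h *m s. *)
Definition star n (h M : 'M[C]_n) : 'M[C]_n := invmx h *m adj M *m h.

End LinearAlgebra.

Record complex_surface (R : realType) := ComplexSurface {
  cs_carrier :> ptopologicalType;
  cs_hausdorff : hausdorff_space cs_carrier;
  cs_second_countable : @second_countable cs_carrier;
  chart : Type;
  cdom : chart -> set cs_carrier;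
  coord : chart -> cs_carrier -> C2 R;
  param : chart -> C2 R -> cs_carrier;
  chart_at : cs_carrier -> chart;
  cdom_open : forall al, open (cdom al);
  chart_atP : forall x, cdom (chart_at x) x;
  coord_open : forall al, open (coord al @` cdom al);
  coordK : forall al x, cdom al x -> param al (coord al x) = x;
  coord_continuous : forall al x, cdom al x -> {for x, continuous (coord al)};
  param_continuous : forall al x, cdom al x ->
    {for coord al x, continuous (param al)};
  transition_holomorphic : forall al be j,
    holomorphic_on (coord be @` (cdom al `&` cdom be))
      (fun p => zcoord j (coord al (param be p)))
}.

Section Surface.
Context {R : realType} (X : complex_surface R).
Local Notation C := R[i].

Definition cimg (al : chart X) (W : set X) : set (C2 R) :=
  coord al @` (cdom al `&` W).

Definition smoothX (al : chart X) (W : set X) (f : X -> R) : Prop :=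
  smooth_on (cimg al W) (fun p => f (param al p)).

Definition csmoothX (al : chart X) (W : set X) (f : X -> C) : Prop :=
  csmooth_on (cimg al W) (fun p => f (param al p)).

Definition holomorphicX (W : set X) (f : X -> C) : Prop :=
  forall al, holomorphic_on (cimg al W) (fun p => f (param al p)).

Definition ccontinuous_on (W : set X) (f : X -> C) : Prop :=
  forall x, W x -> {for x, continuous (fun y => complex.Re (f y))} /\
                   {for x, continuous (fun y => complex.Im (f y))}.

Definition pdX (al : chart X) (k : dir) (f : X -> R) (x : X) : R :=
  pd k (fun p => f (param al p)) (coord al x).

Definition mpdX n (al : chart X) (k : dir) (M : X -> 'M[C]_n) (x : X) :
    'M[C]_n :=
  \matrix_(p, q) cpd k (fun u => M (param al u) p q) (coord al x).

Definition dzX (al : chart X) (j : 'I_2) (f : X -> C) (x : X) : C :=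
  dz j (fun p => f (param al p)) (coord al x).

Definition mdzX n (al : chart X) (j : 'I_2) (M : X -> 'M[C]_n) (x : X) :
    'M[C]_n :=
  \matrix_(p, q) dz j (fun u => M (param al u) p q) (coord al x).

Definition mdzbarX n (al : chart X) (j : 'I_2) (M : X -> 'M[C]_n) (x : X) :
    'M[C]_n :=
  \matrix_(p, q) dzbar j (fun u => M (param al u) p q) (coord al x).

(* d z^al_m / d z^be_j, and its analogue for the real coordinates. *)
Definition cjac (al be : chart X) (m j : 'I_2) (x : X) : C :=
  dzX be j (fun y => zcoord m (coord al y)) x.

Definition rjac (al be : chart X) (l k : dir) (x : X) : R :=
  pdX be k (fun y => rcoord l (coord al y)) x.

(* Every point of X, not only of Z, has a neighbourhood in which Z is cut out
   by finitely many holomorphic functions; in particular Z is closed. *)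
Definition analytic_subvariety (Z : set X) : Prop :=
  forall x : X, exists U : set X, [/\ open U, U x &
    exists m (f : 'I_m -> X -> C), (forall i, holomorphicX U (f i)) /\
      forall y, U y -> (Z y <-> forall i, f i y = 0)].

End Surface.

(** [kmx al x] is the matrix (g_jk) of the Kaehler form
    omega = (i/2) sum_jk g_jk dz_j /\ dzbar_k, so that |dz_j|^2 = 2 for the
    flat metric g = 1 and omega^2 / 2 = det g dx_1 dy_1 dx_2 dy_2. *)

Record kahler_metric (R : realType) (X : complex_surface R) := KahlerMetric {
  kmx : chart X -> X -> 'M[R[i]]_2;
  kmx_smooth : forall al j k, csmoothX al setT (fun x => kmx al x j k);
  kmx_positive : forall al x, cdom al x -> positive_hermitian (kmx al x);
  kmx_chart : forall al be x, cdom al x -> cdom be x -> forall j k,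
    kmx be x j k =
    \sum_m \sum_n cjac al be m j x * conjc (cjac al be n k x) * kmx al x m n;
  (* d omega = 0; the (1,2)-part of this equation is its conjugate *)
  kmx_closed : forall al x, cdom al x -> forall j k l,
    dzX al l (fun y => kmx al y j k) x = dzX al j (fun y => kmx al y l k) x;
  (* the Riemannian measure on the Borel sets of X *)
  vol : {measure set (g_sigma_algebraType (@open X)) -> \bar R};
  volE : forall al (S : set X), (@open X).-sigma.-measurable S -> S `<=` cdom al ->
    vol S = (\int[leb4]_(p in coord al @` S)
      (complex.Re (\det (kmx al (param al p))))%:E)%E
}.

(** A bundle over W is given by local frames indexed by [frame]; [trans a b]
    takes components in frame b to components in frame a.  Geometric objects
    are given by their components in frames and charts, together with their
    transformation rules. *)

Record vector_bundle (R : realType) (X : complex_surface R) (W : set X)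
    (r : nat) := VectorBundle {
  frame : Type;
  fdom : frame -> set X;
  frame_at : X -> frame;
  trans : frame -> frame -> X -> 'M[R[i]]_r;
  fdom_open : forall a, open (fdom a);
  fdom_sub : forall a, fdom a `<=` W;
  frame_atP : forall x, W x -> fdom (frame_at x) x;
  trans_smooth : forall a b al p q,
    csmoothX al (fdom a `&` fdom b) (fun x => trans a b x p q);
  trans_id : forall a x, fdom a x -> trans a a x = 1%:M;
  trans_cocycle : forall a b c x, fdom a x -> fdom b x -> fdom c x ->
    trans a b x *m trans b c x = trans a c x
}.

Record hermitian_metric (R : realType) (X : complex_surface R) (W : set X)
    (r : nat) (E : vector_bundle W r) := HermitianMetric {
  hmx :> frame E -> X -> 'M[R[i]]_r;
  hmx_smooth : forall a al p q, csmoothX al (fdom a) (fun x => hmx a x p q);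
  hmx_positive : forall a x, fdom a x -> positive_hermitian (hmx a x);
  hmx_frame : forall a b x, fdom a x -> fdom b x ->
    hmx b x = adj (trans a b x) *m hmx a x *m trans a b x
}.

Section Bundle.
Context {R : realType} (X : complex_surface R) (W : set X) (r : nat).
Variable E : vector_bundle W r.
Local Notation C := R[i].

Definition connection_form := chart X -> frame E -> dir -> X -> 'M[C]_r.

Definition is_connection (A : connection_form) : Prop :=
  (forall al be a k x, cdom al x -> cdom be x -> fdom a x ->
     A be a k x = \sum_l (rjac al be l k x)%:C%C *: A al a l x) /\
  (forall al a b k x, cdom al x -> fdom a x -> fdom b x ->
     A al b k x = invmx (trans a b x) *m A al a k x *m trans a b x
                  + invmx (trans a b x) *m mpdX al k (trans a b) x).

Definition smooth_connection (A : connection_form) : Prop :=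
  forall al a k p q, csmoothX al (fdom a) (fun x => A al a k x p q).

Definition unitary_connection (h : hermitian_metric E) (A : connection_form) :
    Prop :=
  forall al a k x, cdom al x -> fdom a x ->
    mpdX al k (h a) x = adj (A al a k x) *m h a x + h a x *m A al a k x.

Definition curvature (A : connection_form) al a (k l : dir) (x : X) :
    'M[C]_r :=
  mpdX al k (A al a l) x - mpdX al l (A al a k) x
  + comm (A al a k x) (A al a l x).

Definition conn10 (A : connection_form) al a (j : 'I_2) (x : X) : 'M[C]_r :=
  2^-1 *: (A al a (j, false) x - 'i%C *: A al a (j, true) x).

Definition conn01 (A : connection_form) al a (j : 'I_2) (x : X) : 'M[C]_r :=
  2^-1 *: (A al a (j, false) x + 'i%C *: A al a (j, true) x).

(* The coefficients of dzbar_j /\ dzbar_k and of dz_j /\ dzbar_k in F_A. *)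
Definition curv02 (A : connection_form) al a (j k : 'I_2) (x : X) : 'M[C]_r :=
  mdzbarX al j (conn01 A al a k) x - mdzbarX al k (conn01 A al a j) x
  + comm (conn01 A al a j x) (conn01 A al a k x).

Definition curv11 (A : connection_form) al a (j k : 'I_2) (x : X) : 'M[C]_r :=
  mdzX al j (conn01 A al a k) x - mdzbarX al k (conn10 A al a j) x
  + comm (conn10 A al a j x) (conn01 A al a k x).

(** By Chern-Weil theory, the real first Chern class of E is the de Rham class
    of (i / 2 pi) tr F_A for any connection A on E. *)

Definition is_oneform (b : chart X -> dir -> X -> R) : Prop :=
  (forall al k, smoothX al W (b al k)) /\
  (forall al be k x, W x -> cdom al x -> cdom be x ->
     b be k x = \sum_l rjac al be l k x * b al l x).

Definition c1_eq0 : Prop :=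
  exists (A : connection_form) (b : chart X -> dir -> X -> R),
    [/\ is_connection A, smooth_connection A, is_oneform b &
      forall al a k l x, cdom al x -> fdom a x ->
        'i%C / (2 * pi)%:C%C * \tr (curvature A al a k l x) =
        (pdX al k (b al l) x - pdX al l (b al k) x)%:C%C].

(** A (1,0)-form sum_j phi_j dz_j with values in u(E) (x) C = End(E) is given by
    the matrices of the phi_j. *)

Definition form10 := chart X -> frame E -> 'I_2 -> X -> 'M[C]_r.

Definition is_form10 (phi : form10) : Prop :=
  (forall al be a j x, cdom al x -> cdom be x -> fdom a x ->
     phi be a j x = \sum_m cjac al be m j x *: phi al a m x) /\
  (forall al a b j x, cdom al x -> fdom a x -> fdom b x ->
     phi al b j x = invmx (trans a b x) *m phi al a j x *m trans a b x).

Definition smooth_form10 (phi : form10) : Prop :=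
  forall al a j p q, csmoothX al (fdom a) (fun x => phi al a j x p q).

Definition scale_form10 (c : R) (phi : form10) : form10 :=
  fun al a j x => c%:C%C *: phi al a j x.

End Bundle.

Section Metric.
Context {R : realType} (X : complex_surface R) (K : kahler_metric X).
Context (W : set X) (r : nat) (E : vector_bundle W r) (h : hermitian_metric E).
Local Notation C := R[i].

(* Lambda, the adjoint of omega /\ _, on sum_jk eta_jk dz_j /\ dzbar_k. *)
Definition Lambda (al : chart X) (x : X) (eta : 'I_2 -> 'I_2 -> 'M[C]_r) :
    'M[C]_r :=
  (- 2 * 'i%C) *: \sum_j \sum_k invmx (kmx K al x) k j *: eta j k.

(* The pointwise norm; it does not depend on the chart al and the frame a, so
   [norm10] may use any choice of them at x. *)
Definition pnorm (al : chart X) (a : frame E) (x : X) (phi : 'I_2 -> 'M[C]_r) :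
    R :=
  Num.sqrt (complex.Re (2 * \sum_j \sum_k
    invmx (kmx K al x) k j * \tr (phi j *m star (h a x) (phi k)))).

Definition norm10 (phi : form10 E) (x : X) : R :=
  pnorm (chart_at x) (frame_at E x) x
    (fun j => phi (chart_at x) (frame_at E x) j x).

Definition L2norm10 (phi : form10 E) : R :=
  Num.sqrt (\int[vol K]_x (norm10 phi x ^+ 2))%R.

(* In components, with phi^* = sum_k (phi_k)^* dzbar_k and
   [phi /\ phi^*] = sum_jk [phi_j, (phi_k)^*] dz_j /\ dzbar_k. *)
Definition simpson (A : connection_form E) (phi : form10 E) : Prop :=
  forall al a x, cdom al x -> fdom a x ->
  [/\ forall j k, mdzbarX al k (phi al a j) x
                  + comm (conn01 A al a k x) (phi al a j x) = 0,
      forall j k, comm (phi al a j x) (phi al a k x) = 0,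
      forall j k, curv02 A al a j k x = 0 &
      Lambda al x (fun j k => curv11 A al a j k x
        + 2 *: comm (phi al a j x) (star (h a x) (phi al a k x))) = 0].

End Metric.

(** A map F -> E|_W is given by the matrices [g a c x] taking components in the
    frame c of F to components in the frame a of E. *)

Section Isometry.
Context {R : realType} (X : complex_surface R) (W : set X) (r : nat).
Context (E : vector_bundle [set: X] r) (h : hermitian_metric E).
Context (F : vector_bundle W r) (hF : hermitian_metric F).
Local Notation C := R[i].

Definition bundle_map := frame E -> frame F -> X -> 'M[C]_r.

Definition is_isometry (g : bundle_map) : Prop :=
  [/\ forall a c al p q,
        csmoothX al (fdom a `&` fdom c) (fun x => g a c x p q),
      forall a b c d x, fdom a x -> fdom b x -> fdom c x -> fdom d x ->
        g a c x = trans a b x *m g b d x *m trans d c x,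
      forall a c x, fdom a x -> fdom c x -> g a c x \in unitmx &
      forall a c x, fdom a x -> fdom c x ->
        adj (g a c x) *m h a x *m g a c x = hF c x].

(* Components in the frame c of the pull-backs by g; by the transformation
   rules they do not depend on the auxiliary frame a of E. *)
Definition pull_form10 (g : bundle_map) (phi : form10 E) al a c j x : 'M[C]_r :=
  invmx (g a c x) *m phi al a j x *m g a c x.

Definition pull_connection (g : bundle_map) (A : connection_form E)
    al a c k x : 'M[C]_r :=
  invmx (g a c x) *m A al a k x *m g a c x
  + invmx (g a c x) *m mpdX al k (g a c) x.

End Isometry.

Record real_line_bundle (R : realType) (X : complex_surface R) (W : set X) :=
    RealLineBundle {
  lframe : Type;
  ldom : lframe -> set X;
  lframe_at : X -> lframe;
  ltrans : lframe -> lframe -> X -> R;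
  lnorm2 : lframe -> X -> R;  (* the squared length of the frame *)
  ldom_open : forall e, open (ldom e);
  ldom_sub : forall e, ldom e `<=` W;
  lframe_atP : forall x, W x -> ldom (lframe_at x) x;
  ltrans_smooth : forall e f al,
    smoothX al (ldom e `&` ldom f) (ltrans e f);
  ltrans_id : forall e x, ldom e x -> ltrans e e x = 1;
  ltrans_cocycle : forall e f d x, ldom e x -> ldom f x -> ldom d x ->
    ltrans e f x * ltrans f d x = ltrans e d x;
  lnorm2_smooth : forall e al, smoothX al (ldom e) (lnorm2 e);
  lnorm2_gt0 : forall e x, ldom e x -> 0 < lnorm2 e x;
  lnorm2_frame : forall e f x, ldom e x -> ldom f x ->
    lnorm2 f x = ltrans e f x ^+ 2 * lnorm2 e x
}.

Section LineBundle.
Context {R : realType} (X : complex_surface R) (W : set X).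
Variable J : real_line_bundle W.
Local Notation C := R[i].

(* The components of a section of J (x) Omega^1_X, i.e. of (J (x) C) (x) Omega^1_X,
   are complex numbers. *)
Definition lsection10 := chart X -> lframe J -> 'I_2 -> X -> C.

Definition is_lsection10 (mu : lsection10) : Prop :=
  [/\ forall al be e j x, cdom al x -> cdom be x -> ldom e x ->
        mu be e j x = \sum_m cjac al be m j x * mu al e m x,
      forall al e f j x, cdom al x -> ldom e x -> ldom f x ->
        mu al e j x = (ltrans e f x)%:C%C * mu al f j x &
      forall al e j, ccontinuous_on (cdom al `&` ldom e) (mu al e j)].

Context (r : nat) (F : vector_bundle W r) (hF : hermitian_metric F).

(* [tau e c x] is the matrix, in the frame c, of the image of the frame e. *)
Definition line_map := lframe J -> frame F -> X -> 'M[C]_r.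

Definition is_isometric_line_map (tau : line_map) : Prop :=
  [/\ forall e f c x, ldom e x -> ldom f x -> fdom c x ->
        tau f c x = (ltrans e f x)%:C%C *: tau e c x,
      forall e c d x, ldom e x -> fdom c x -> fdom d x ->
        tau e d x = invmx (trans c d x) *m tau e c x *m trans c d x,
      forall e c p q,
        ccontinuous_on (ldom e `&` fdom c) (fun x => tau e c x p q),
      forall e c x, ldom e x -> fdom c x ->
        star (hF c x) (tau e c x) = - tau e c x &
      forall e c x, ldom e x -> fdom c x ->
        \tr (tau e c x *m star (hF c x) (tau e c x)) = (lnorm2 e x)%:C%C].

(* tau o mu, computed with the frame e of J; it does not depend on e. *)
Definition line_comp (tau : line_map) (mu : lsection10) al e c j x : 'M[C]_r :=
  mu al e j x *: tau e c x.

End LineBundle.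

(** The data provided by Taubes' analysis of a sequence (A_n, phi_n) in which
    phi_n is normalised to have L^2 norm 1.  The infinite set Xi of indices is the range of [xi]. *)

Record taubes_limit (R : realType) (X : complex_surface R)
    (K : kahler_metric X) (E : vector_bundle [set: X] 2)
    (h : hermitian_metric E) (A : nat -> connection_form E)
    (phi : nat -> form10 E) := TaubesLimit {
  xi : nat -> nat;
  xi_increasing : {homo xi : m n / (m < n)%N};
  Theta : set X;
  Theta_finite : finite_set Theta;
  phihat : X -> R;  (* the function |phihat_diamond| *)
  phihat_ge0 : forall x, 0 <= phihat x;
  phihat_L21 : forall al : chart X,
    L21_cvg (cimg al setT) (fun n p => norm10 K h (phi (xi n)) (param al p))
      (fun p => phihat (param al p));
  phihat_continuous : forall x, ~ Theta x -> {for x, continuous phihat};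
  phihat_C0 : forall S : set X, compact S -> S `<=` ~` Theta ->
    forall eps : R, 0 < eps -> \forall n \near \oo,
      forall x, S x -> `|norm10 K h (phi (xi n)) x - phihat x| < eps;
  singular_set : set X := [set x | phihat x = 0];
  singular_closed : closed singular_set;
  singular_nowhere_dense : (closure singular_set)° = set0;
  regular_set : set X := ~` (Theta `|` singular_set);
  limit_line : real_line_bundle regular_set;
  mu : lsection10 limit_line;
  muP : is_lsection10 mu;
  limit_bundle : vector_bundle regular_set 2;
  limit_metric : hermitian_metric limit_bundle;
  limit_connection : connection_form limit_bundle;
  limit_connectionP : is_connection limit_connection;
  tau : line_map limit_line limit_bundle;
  tauP : is_isometric_line_map limit_metric tau;
  gauge : nat -> bundle_map E limit_bundle;
  gaugeP : forall n, is_isometry h limit_metric (gauge n);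
  (* Convergence in L^2_1 on compact subsets of the regular set: it is enough
     to test it on the compact subsets of the domains on which a chart and all
     the frames are defined, since these domains are an open cover. *)
  phi_L21 : forall al a c e j p q,
    cL21_cvg (cimg al (fdom a `&` fdom c `&` ldom e))
      (fun n u =>
         pull_form10 (gauge n) (phi (xi n)) al a c j (param al u) p q)
      (fun u => line_comp tau mu al e c j (param al u) p q);
  phi_C0 : forall S : set X, compact S -> S `<=` ~` Theta ->
    forall eps : R, 0 < eps -> \forall n \near \oo,
      forall x, S x -> regular_set x ->
        let al := chart_at x in
        let c := frame_at limit_bundle x in
        pnorm K limit_metric al c x (fun j =>
          pull_form10 (gauge n) (phi (xi n)) al (frame_at E x) c j x
          - line_comp tau mu al (lframe_at limit_line x) c j x) < eps;
  A_L21 : forall al a c k p q,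
    cL21_cvg (cimg al (fdom a `&` fdom c))
      (fun n u =>
         pull_connection (gauge n) (A (xi n)) al a c k (param al u) p q)
      (fun u => limit_connection al c k (param al u) p q)
}.

(* Main.v *)
(** By Simpson's first equation the quadratic differentials q_n = tr (phi_n (x) phi_n),
    normalised by r_n^2, have holomorphic coefficients.  Away from the bubbling
    points Theta they converge locally uniformly, to 0 on Z and to
    (mu (x) mu) tr (tau^2) off Z; the latter does not vanish because tau is
    skew-Hermitian of positive length and |tau o mu| = |phihat|.  Around any point
    of X there is a cube whose boundary avoids Theta, so the maximum
    principle propagates uniform convergence to the interior, where Bernstein's
    gradient estimate makes all derivatives converge: the limit q is holomorphic
    across Theta, and Z is its zero set up to points of Theta. *)

Require Import Defs.
From HB Require Import structures.
From mathcomp Require Import all_boot all_order all_algebra.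
From mathcomp Require Import all_classical all_reals all_analysis.
From mathcomp Require Import complex.
From mathcomp Require Import ring lra.
(* [vector.coord] would otherwise shadow the coordinates of a chart. *)
Import Defs.
Set Implicit Arguments.
Unset Strict Implicit.
Unset Printing Implicit Defensive.
Import Order.TTheory GRing.Theory Num.Theory numFieldNormedType.Exports.
Local Open Scope classical_set_scope.
Local Open Scope ring_scope.

(** * Directional derivatives on C^2 *)

(** Traces are used because they forget the gauges: no convergence of the maps [gauge n] themselves
    is part of the data, but tr (phi_j phi_j) is unchanged under conjugation, so it can be compared
    with the limit through the pull-backs. The two coefficients of dz_j^2 suffice, because off Z the
    limit form is mu_j tau and tr (tau^2) is nonzero. The obstacle is a bubbling point x0, where the
    data say nothing about the limit of q_n. Convergence is therefore expressed as a uniform Cauchy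
    property, which passes from the boundary of a cube to its interior without naming a limit; only
    afterwards is the limit identified, at the points other than x0. Real and imaginary parts of
    holomorphic functions are harmonic for the flat Laplacian of a chart. The whole limit argument
    thus concerns real harmonic functions, with a maximum principle and a gradient bound in place of
    Cauchy's integral formula. *)

Section LineCalculus.
Context {R : realType} {V : normedModType R}.
Implicit Types (f : V -> R) (p u v : V).

Lemma nbhs_normE p (A : set V) :
  nbhs p A <-> exists2 r : R, 0 < r & forall q, `|q - p| < r -> A q.
Proof.
split.
  move=> /nbhs_ballP[r /= r0 rA]; exists r => // q qp; apply: rA.
  by rewrite -ball_normE /= distrC.
move=> [r r0 rA]; apply/nbhs_ballP; exists r => //= q; rewrite -ball_normE /= => pq.
by apply: rA; rewrite distrC.
Qed.

Lemma continuous_normE f p : {for p, continuous f} <->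
  forall e, 0 < e -> exists2 r : R, 0 < r & forall q, `|q - p| < r -> `|f q - f p| < e.
Proof.
split.
  move=> fc e e0; move: (fc) => /cvgrPdist_lt /(_ e e0) /nbhs_normE[r r0 H].
  by exists r => // q /H; rewrite /= distrC.
move=> H; apply/cvgrPdist_lt => e e0; apply/nbhs_normE.
have [r r0 rH] := H e e0; exists r => // q /rH; by rewrite /= distrC.
Qed.

Lemma is_derive_line f p v (t : R) : derivable f (p + t *: v) v ->
  is_derive t 1 (fun s : R => f (p + s *: v)) ('D_v f (p + t *: v)).
Proof.
move=> df.
have E : (fun h : R => h^-1 *: (((fun s : R => f (p + s *: v)) \o shift t) (h *: 1)
            - f (p + t *: v))) =
         (fun h => h^-1 *: ((f \o shift (p + t *: v)) (h *: v) - f (p + t *: v))).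
  apply/funext => h /=; congr (_ *: (f _ - _)).
  by rewrite [h *: 1]mulr1 scalerDl addrCA.
split; first by rewrite /derivable E.
by rewrite /derive E.
Qed.

Lemma mean_value_line f p v (t : R) :
  (forall s : R, `|s| <= `|t| -> derivable f (p + s *: v) v) ->
  exists2 c : R, `|c| <= `|t| & f (p + t *: v) - f p = t * 'D_v f (p + c *: v).
Proof.
move=> df.
pose g (s : R) := f (p + s *: v).
have dg (s : R) : `|s| <= `|t| -> is_derive s 1 g ('D_v f (p + s *: v)).
  by move=> st; apply: is_derive_line; exact: df.
have gc (s : R) : `|s| <= `|t| -> {for s, continuous g}.
  move=> st; apply: differentiable_continuous; apply/derivable1_diffP.
  by have [] := dg s st.
have g0 : f p = g 0 by rewrite /g scale0r addr0.
rewrite g0 -/(g t).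
case: (leP 0 t) => t0.
  have st (s : R) : 0 <= s -> s <= t -> `|s| <= `|t|.
    by move=> s0 st; rewrite !ger0_norm // (le_trans s0).
  have [||c] := @MVT_segment R g (fun s => 'D_v f (p + s *: v)) 0 t t0.
  - by move=> s /[!in_itv]/= /andP[/ltW s0 /ltW s1]; apply: dg; exact: st.
  - apply: continuous_in_subspaceT => s /set_mem /=.
    by rewrite in_itv /= => /andP[? ?]; apply: gc; exact: st.
  rewrite in_itv /= => /andP[c0 ct] ->; exists c; first exact: st.
  by rewrite subr0 mulrC.
have st (s : R) : t <= s -> s <= 0 -> `|s| <= `|t|.
  by move=> s0 st; rewrite !ler0_norm ?lerN2 // ltW.
have [||c] := @MVT_segment R g (fun s => 'D_v f (p + s *: v)) t 0 (ltW t0).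
- by move=> s /[!in_itv]/= /andP[/ltW s0 /ltW s1]; apply: dg; exact: st.
- apply: continuous_in_subspaceT => s /set_mem /=.
  by rewrite in_itv /= => /andP[? ?]; apply: gc; exact: st.
rewrite in_itv /= => /andP[c0 ct]; rewrite sub0r => E; exists c; first exact: st.
by rewrite -opprB E mulrN opprK mulrC.
Qed.

(** The mean value theorem is applied to f(x + s v) - f(x) in the direction u, then to the
    derivative of f along u in the direction v. With u and v exchanged it yields the symmetry of
    mixed derivatives, with u = v the second derivative test. *)
Lemma double_difference f p u v (s : R) :
  (forall a b : R, `|a| <= `|s| -> `|b| <= `|s| ->
     derivable f (p + a *: u + b *: v) u /\
     derivable ('D_u f) (p + a *: u + b *: v) v) ->
  exists c d : R, [/\ `|c| <= `|s|, `|d| <= `|s| &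
    f (p + s *: u + s *: v) - f (p + s *: u) - f (p + s *: v) + f p =
    s * s * 'D_v ('D_u f) (p + c *: u + d *: v)].
Proof.
move=> H.
pose g x := f (x + s *: v) - f x.
have dsh (a : R) : `|a| <= `|s| ->
    is_derive (p + a *: u) u (fun x => f (x + s *: v)) ('D_u f (p + a *: u + s *: v)).
  move=> ha; have [df _] := H a s ha (lexx _).
  have E : (fun h : R => h^-1 *: (((fun x => f (x + s *: v)) \o shift (p + a *: u)) (h *: u)
      - f (p + a *: u + s *: v))) =
     (fun h => h^-1 *: ((f \o shift (p + a *: u + s *: v)) (h *: u) - f (p + a *: u + s *: v))).
    by apply/funext => h /=; rewrite !addrA.
  by split; rewrite ?/derivable ?/derive E.
have df0 (a : R) : `|a| <= `|s| -> derivable f (p + a *: u) u.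
  move=> ha; have [|+ _] := H a 0 ha; first by rewrite normr0 normr_ge0.
  by rewrite scale0r addr0.
have dg (a : R) : `|a| <= `|s| -> is_derive (p + a *: u) u g
    ('D_u f (p + a *: u + s *: v) - 'D_u f (p + a *: u)).
  move=> ha; apply: is_deriveB; first exact: dsh.
  by apply: derivableP; exact: df0.
have [|c cs Ec] := @mean_value_line g p u s.
  by move=> a /dg[].
have [|d ds Ed] := @mean_value_line ('D_u f) (p + c *: u) v s.
  by move=> b bs; have [_] := H c b cs bs.
exists c, d; split => //.
rewrite -mulrA -Ed; have [_ <-] := dg c cs; rewrite -Ec /g.
by rewrite opprB addrA addrAC.
Qed.

(** The double difference is symmetric in u and v, so the two mixed derivatives take a common value
    at two points arbitrarily close to p. By continuity they cannot differ at p. *)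
Lemma derive_commute f p u v (r : R) : 0 < r ->
  (forall q, `|q - p| < r -> [/\ derivable f q u, derivable f q v,
     derivable ('D_u f) q v & derivable ('D_v f) q u]) ->
  {for p, continuous ('D_v ('D_u f))} -> {for p, continuous ('D_u ('D_v f))} ->
  'D_v ('D_u f) p = 'D_u ('D_v f) p.
Proof.
move=> r0 H c1 c2; apply/eqP/negPn/negP => ne.
pose e := `|'D_v ('D_u f) p - 'D_u ('D_v f) p| / 2.
have e0 : 0 < e by rewrite divr_gt0 // normr_gt0 subr_eq0.
have [r1 r10 H1] := (continuous_normE _ _).1 c1 e e0.
have [r2 r20 H2] := (continuous_normE _ _).1 c2 e e0.
pose m := Num.min r (Num.min r1 r2).
have m0 : 0 < m by rewrite !lt_min r0 r10 r20.
pose n := `|u| + `|v| + 1.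
have n0 : 0 < n by rewrite ltr_pwDr // addr_ge0.
(* All sampled points lie within s (|u| + |v|) <= m / 2 of p; the summand 1 in [n] keeps the
   quotient meaningful when u = v = 0. *)
pose s := m / (2 * n).
have s0 : 0 < s by rewrite divr_gt0 // mulr_gt0.
have small (a b : R) : `|a| <= `|s| -> `|b| <= `|s| -> `|p + a *: u + b *: v - p| < m.
  move=> ha hb; rewrite -(addrA p) addrAC subrr add0r.
  rewrite (@le_lt_trans _ _ (s * n)) //.
    rewrite (le_trans (ler_normD _ _)) // !normrZ.
    rewrite (gtr0_norm s0) in ha hb.
    rewrite /n -addrA mulrDr lerD ?ler_wpM2r // mulrDr mulr1.
    by rewrite (le_trans (ler_wpM2r _ hb)) // lerDl ltW.
  rewrite /s invfM mulrA mulfVK ?gt_eqF // ltr_pdivrMr // ltr_pMr //.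
  by rewrite ltr1n.
have sm (a b : R) : `|a| <= `|s| -> `|b| <= `|s| ->
    [/\ `|p + a *: u + b *: v - p| < r, `|p + a *: u + b *: v - p| < r1
      & `|p + a *: u + b *: v - p| < r2].
  by move=> ha hb; have := small a b ha hb; rewrite !lt_min => /and3P[].
have [|c [d [hc hd E]]] := @double_difference f p u v s.
  by move=> a b ha hb; have [k _ _] := sm a b ha hb; have [d1 _ d2 _] := H _ k; split; [exact: d1|exact: d2].
have [|d' [c' [hd' hc' E']]] := @double_difference f p v u s.
  by move=> a b ha hb; have [k _ _] := sm b a hb ha; rewrite addrAC; have [_ d1 _ d2] := H _ k; split; [exact: d1|exact: d2].
have : 'D_v ('D_u f) (p + c *: u + d *: v) = 'D_u ('D_v f) (p + d' *: v + c' *: u).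
  have : s * s != 0 by rewrite mulf_neq0 // gt_eqF.
  move=> /mulfI; apply; rewrite -E -E' (addrAC p (s *: v)).
  by congr (_ + _); exact: addrAC.
have [_ k1 _] := sm c d hc hd; have L1 := H1 _ k1.
have [_ _ k2] := sm c' d' hc' hd'; have L2 := H2 _ k2.
move=> EE; rewrite EE in L1; rewrite addrAC in L2.
have : `|'D_v ('D_u f) p - 'D_u ('D_v f) p| < e + e.
  apply: le_lt_trans (ler_distD ('D_u ('D_v f) (p + d' *: v + c' *: u)) _ _) _.
  by apply: ltrD; [rewrite distrC; exact: L1 | exact: L2].
by rewrite /e -splitr ltxx.
Qed.

End LineCalculus.

(** * Smooth functions and the rules for their partial derivatives *)

Section SmoothCalculus.
Context {R : realType}.
Local Notation V := (C2 R).
Implicit Types (O : set V) (f g : V -> R) (p : V).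

Lemma near_open O p : open O -> O p -> nbhs p O.
Proof. by rewrite openE => oO /oO. Qed.

(** Smoothness of finite order, peeling off the innermost derivative. The product and chain rules
    replace one function by a sum of products, which suits an induction on the order for all
    functions at once better than the iterated derivatives [foldr pd f s]. *)
Fixpoint ksmooth (n : nat) O f : Prop :=
  (forall p, O p -> {for p, continuous f} /\ forall k, derivable f p (dirv k)) /\
  if n is m.+1 then forall k, ksmooth m O (pd k f) else True.

Lemma ksmoothW n O f : ksmooth n.+1 O f -> ksmooth n O f.
Proof.
elim: n f => [|n IH] f [h1 h2]; split => //.
by move=> k; apply: IH; exact: h2.
Qed.

Lemma smooth_ksmooth O f : smooth_on O f <-> forall n, ksmooth n O f.
Proof.
split=> [+ n|].
  elim: n f => [|n IH] f sf; (split; first exact: (sf [::])) => // k.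
  by apply: IH => s; rewrite -foldr_rcons; exact: sf.
move=> + s; elim/last_ind: s f => [|s k IH] f sf; first exact: (sf 0).1.
by rewrite foldr_rcons; apply: IH => n; exact: (sf n.+1).2.
Qed.

Lemma smooth0 O f p : smooth_on O f -> O p ->
  {for p, continuous f} /\ forall k, derivable f p (dirv k).
Proof. by move=> sf; exact: (sf [::]). Qed.

Lemma smooth_cont O f p : smooth_on O f -> O p -> {for p, continuous f}.
Proof. by move=> sf Op; have [] := smooth0 sf Op. Qed.

Lemma smooth_drv O f p k : smooth_on O f -> O p -> derivable f p (dirv k).
Proof. by move=> sf Op; have [] := smooth0 sf Op. Qed.

Lemma smooth_pd O f k : smooth_on O f -> smooth_on O (pd k f).
Proof. by move=> sf s; rewrite -foldr_rcons; exact: sf. Qed.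

Lemma smooth_onW O O' f : O' `<=` O -> smooth_on O f -> smooth_on O' f.
Proof. by move=> OO sf s p /OO; exact: sf. Qed.

Lemma near_eq_pd k f g p : (\forall q \near p, f q = g q) -> pd k f p = pd k g p.
Proof. by move=> fg; apply: near_eq_derive. Qed.

Lemma ksmooth_ext n O f g : open O -> (forall q, O q -> f q = g q) ->
  ksmooth n O f -> ksmooth n O g.
Proof.
move=> oO; elim: n f g => [|n IH] f g fg [h1 h2].
all: have near_fg p : O p -> \forall q \near p, f q = g q
  by move=> Op; apply: filterS (near_open oO Op).
all: split=> [p Op|//].
1,2: split=> [|k].
1,3: rewrite /prop_for /continuous_at -fg //.
1,2: by apply: cvg_trans (h1 p Op).1; apply: near_eq_cvg; exact: near_fg.
1,2: by apply: near_eq_derivable (near_fg p Op) ((h1 p Op).2 k).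
by move=> k; apply: IH (h2 k) => q Oq; apply: near_eq_pd; exact: near_fg.
Qed.

Lemma smooth_ext O f g : open O -> (forall q, O q -> f q = g q) ->
  smooth_on O f -> smooth_on O g.
Proof.
move=> oO fg /smooth_ksmooth h; apply/smooth_ksmooth => n; exact: ksmooth_ext fg (h n).
Qed.

Lemma smooth_local O f :
  (forall p, O p -> exists U, [/\ U p, U `<=` O & smooth_on U f]) -> smooth_on O f.
Proof. by move=> h s p Op; have [U [Up _ sf]] := h p Op; exact: sf. Qed.

Lemma pdD k f g p : derivable f p (dirv k) -> derivable g p (dirv k) ->
  pd k (fun q => f q + g q) p = pd k f p + pd k g p.
Proof. by move=> df dg; rewrite /pd -(deriveD df dg). Qed.

Lemma pdM k f g p : derivable f p (dirv k) -> derivable g p (dirv k) ->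
  pd k (fun q => f q * g q) p = f p * pd k g p + g p * pd k f p.
Proof. by move=> df dg; rewrite /pd; have := deriveM df dg. Qed.

Lemma pd_cst k (c : R) p : pd k (fun=> c) p = 0.
Proof. exact: derive_cst. Qed.

Lemma ksmooth_cst n O (c : R) : ksmooth n O (fun=> c).
Proof.
elim: n c => [|n IH] c; split=> [p Op|//].
1,2: split=> [|k]; [exact: cst_continuous|exact: derivable_cst].
by move=> k; have -> : pd k (fun=> c) = fun=> 0 by apply/funext => p; exact: pd_cst.
Qed.

Lemma smooth_cst O (c : R) : smooth_on O (fun=> c).
Proof. by apply/smooth_ksmooth => n; exact: ksmooth_cst. Qed.

Lemma ksmooth0 n O f : ksmooth n O f ->
  forall p, O p -> {for p, continuous f} /\ forall k, derivable f p (dirv k).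
Proof. by case: n => [|n] []. Qed.

Lemma ksmoothD n O f g : open O -> ksmooth n O f -> ksmooth n O g ->
  ksmooth n O (fun q => f q + g q).
Proof.
move=> oO; elim: n f g => [|n IH] f g sf sg; have f0 := ksmooth0 sf; have g0 := ksmooth0 sg.
all: have s0 : forall p, O p -> {for p, continuous (fun q => f q + g q)} /\
  forall k, derivable (fun q => f q + g q) p (dirv k)
  by move=> p Op; have [fc fd] := f0 p Op; have [gc gd] := g0 p Op; split=> [|k];
   [exact: continuousD fc gc|exact: derivableD (fd k) (gd k)].
all: split=> [//|//]; move=> k.
apply: (@ksmooth_ext _ _ (fun q => pd k f q + pd k g q)) => //.
  by move=> q Oq; rewrite pdD; [|exact: (f0 q Oq).2|exact: (g0 q Oq).2].
by apply: IH; [exact: sf.2|exact: sg.2].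
Qed.

Lemma ksmoothM n O f g : open O -> ksmooth n O f -> ksmooth n O g ->
  ksmooth n O (fun q => f q * g q).
Proof.
move=> oO; elim: n f g => [|n IH] f g sf sg; have f0 := ksmooth0 sf; have g0 := ksmooth0 sg.
all: have s0 : forall p, O p -> {for p, continuous (fun q => f q * g q)} /\
  forall k, derivable (fun q => f q * g q) p (dirv k)
  by move=> p Op; have [fc fd] := f0 p Op; have [gc gd] := g0 p Op; split=> [|k];
   [exact: continuousM fc gc|exact: derivableM (fd k) (gd k)].
all: split=> [//|//]; move=> k.
apply: (@ksmooth_ext _ _ (fun q => f q * pd k g q + g q * pd k f q)) => //.
  by move=> q Oq; rewrite pdM; [|exact: (f0 q Oq).2|exact: (g0 q Oq).2].
by apply: ksmoothD => //; apply: IH; [exact: ksmoothW|exact: sg.2|exact: ksmoothW|exact: sf.2].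
Qed.

Lemma smoothD O f g : open O -> smooth_on O f -> smooth_on O g ->
  smooth_on O (fun q => f q + g q).
Proof.
move=> oO /smooth_ksmooth sf /smooth_ksmooth sg; apply/smooth_ksmooth => n.
exact: ksmoothD.
Qed.

Lemma smoothM O f g : open O -> smooth_on O f -> smooth_on O g ->
  smooth_on O (fun q => f q * g q).
Proof.
move=> oO /smooth_ksmooth sf /smooth_ksmooth sg; apply/smooth_ksmooth => n.
exact: ksmoothM.
Qed.

Lemma smoothZ O (c : R) f : open O -> smooth_on O f -> smooth_on O (fun q => c * f q).
Proof. by move=> oO sf; apply: smoothM => //; exact: smooth_cst. Qed.

Lemma smoothN O f : open O -> smooth_on O f -> smooth_on O (fun q => - f q).
Proof.
move=> oO /(smoothZ (-1) oO); apply: smooth_ext => // q _; exact: mulN1r.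
Qed.

Lemma smoothB O f g : open O -> smooth_on O f -> smooth_on O g ->
  smooth_on O (fun q => f q - g q).
Proof. by move=> oO sf sg; apply: smoothD => //; exact: smoothN. Qed.

Lemma pdZ k (c : R) f p : derivable f p (dirv k) ->
  pd k (fun q => c * f q) p = c * pd k f p.
Proof.
move=> df; have := pdM (derivable_cst c p (dirv k)) df.
by rewrite pd_cst mulr0 addr0.
Qed.

Lemma pdN k f p : derivable f p (dirv k) -> pd k (fun q => - f q) p = - pd k f p.
Proof. by move=> df; rewrite /pd; have := deriveN df. Qed.

Lemma pdB k f g p : derivable f p (dirv k) -> derivable g p (dirv k) ->
  pd k (fun q => f q - g q) p = pd k f p - pd k g p.
Proof. by move=> df dg; rewrite /pd; have := deriveB df dg. Qed.

Lemma pd_commute O f k l p : open O -> smooth_on O f -> O p ->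
  pd l (pd k f) p = pd k (pd l f) p.
Proof.
move=> oO sf Op; have /nbhs_normE[r r0 H] := near_open oO Op.
apply: (derive_commute r0).
- move=> q /H Oq; split.
  + exact: smooth_drv sf Oq.
  + exact: smooth_drv sf Oq.
  + exact: smooth_drv (smooth_pd k sf) Oq.
  + exact: smooth_drv (smooth_pd l sf) Oq.
- exact: smooth_cont (smooth_pd l (smooth_pd k sf)) Op.
- exact: smooth_cont (smooth_pd k (smooth_pd l sf)) Op.
Qed.

End SmoothCalculus.

(** * Harmonic functions *)

Section Laplacian.
Context {R : realType}.
Local Notation V := (C2 R).
Implicit Types (O : set V) (f g : V -> R) (p : V).

Lemma is_derive_additive (f : V -> R) p v :
  (forall h : R, f (h *: v + p) = h * f v + f p) -> is_derive p v f (f v).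
Proof.
move=> lf.
have E : (fun h : R => h^-1 *: ((f \o shift p) (h *: v) - f p)) @ 0^' --> f v.
  apply: cvg_near_cst; near=> h; rewrite /= lf addrK [_ *: _]mulrA mulVf ?mul1r //.
  by near: h; exact: nbhs_dnbhs_neq.
by split; [apply/cvg_ex; exists (f v)|exact: cvg_lim E].
Unshelve. all: by end_near. Qed.

Lemma rcoord_linear (k : dir) (h : R) (u v : V) :
  rcoord k (h *: u + v) = h * rcoord k u + rcoord k v.
Proof.
case: u v => -[u1 u2] [u3 u4] [[v1 v2] [v3 v4]].
by rewrite /rcoord /zcoord; case: ifP => _; case: ifP => _ /=.
Qed.

Lemma rcoordD (k : dir) (u v : V) : rcoord k (u + v) = rcoord k u + rcoord k v.
Proof. by rewrite -[u in LHS]scale1r rcoord_linear mul1r. Qed.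

Lemma rcoordZ (k : dir) (h : R) (u : V) : rcoord k (h *: u) = h * rcoord k u.
Proof. by apply: (addIr (rcoord k u)); rewrite -rcoord_linear -rcoordD. Qed.

Lemma rcoordB (k : dir) (u v : V) : rcoord k (u - v) = rcoord k u - rcoord k v.
Proof. by rewrite rcoordD -scaleN1r rcoordZ mulN1r. Qed.

Lemma rcoord_dirv (k l : dir) : rcoord l (dirv k) = (k == l)%:R :> R.
Proof.
case: k l => [k a] [l b]; rewrite /rcoord /zcoord /dirv xpair_eqE /=.
have [-> ->] : (k == 0) = (val k == 0)%N /\ (l == 0) = (val l == 0)%N by [].
have -> : (k == l) = ((val k == 0)%N == (val l == 0)%N).
  by case: k l => [[|[|k]] //= ?] [[|[|l]] //= ?].
by case: eqP => _; case: eqP => _; case: a; case: b.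
Qed.

Lemma rcoord_le_norm (k : dir) p : `|rcoord k p| <= `|p|.
Proof.
case: p k => -[p1 p2] [p3 p4] [k b]; rewrite /rcoord /zcoord /= !prod_normE /=.
by case: ifP => _; case: ifP => _ /=; rewrite !le_max lexx ?orbT.
Qed.

(** The norm of the product type is the maximum of the four real coordinates, so the balls of this
    norm are cubes. *)
Lemma norm_le_rcoord p (r : R) : (forall k, `|rcoord k p| <= r) -> `|p| <= r.
Proof.
case: p => -[p1 p2] [p3 p4] H; rewrite !prod_normE /= !ge_max.
by rewrite (H (0, false)) (H (0, true)) (H (1, false)) (H (1, true)).
Qed.

Lemma norm_dirv (k : dir) : `|dirv k : V| <= 1.
Proof.
by apply: norm_le_rcoord => l; rewrite rcoord_dirv; case: (_ == _); rewrite ?normr1 ?normr0.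
Qed.

Lemma rcoord_derive (k l : dir) p : is_derive p (dirv k) (@rcoord R l) (k == l)%:R.
Proof.
by rewrite -rcoord_dirv; apply: is_derive_additive => h; exact: rcoord_linear.
Qed.

Lemma rcoord_continuous (k : dir) : continuous (@rcoord R k).
Proof.
move=> p; apply/continuous_normE => e e0; exists e => // q qp.
rewrite -rcoordB.
exact: le_lt_trans (rcoord_le_norm _ _) qp.
Qed.

Lemma smooth_rcoord O (l : dir) : smooth_on O (@rcoord R l).
Proof.
apply/smooth_ksmooth => -[|n]; split=> [p Op|//].
- by split=> [|k]; [exact: rcoord_continuous|have [] := rcoord_derive k l p].
- by split=> [|k]; [exact: rcoord_continuous|have [] := rcoord_derive k l p].
move=> k.
have -> : pd k (@rcoord R l) = fun=> (k == l)%:R.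
  by apply/funext => p; have [] := rcoord_derive k l p.
exact: ksmooth_cst.
Qed.

Lemma pd_rcoord (k l : dir) p : pd k (@rcoord R l) p = (k == l)%:R.
Proof. by have [] := rcoord_derive k l p. Qed.

Lemma smooth_sum (I : Type) (s : seq I) O (F : I -> V -> R) : open O ->
  (forall i, smooth_on O (F i)) -> smooth_on O (fun p => \sum_(i <- s) F i p).
Proof.
move=> oO sF; elim: s => [|i s IH].
  by apply: (smooth_ext oO _ (smooth_cst 0)) => p _; rewrite big_nil.
by apply: (smooth_ext oO _ (smoothD oO (sF i) IH)) => p _; rewrite big_cons.
Qed.

Lemma pd_sum (I : Type) (s : seq I) O (F : I -> V -> R) k p : open O -> O p ->
  (forall i, smooth_on O (F i)) ->
  pd k (fun p => \sum_(i <- s) F i p) p = \sum_(i <- s) pd k (F i) p.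
Proof.
move=> oO Op sF; elim: s => [|i s IH].
  rewrite big_nil -[RHS](pd_cst k 0 p); congr (pd k _ p); apply/funext => q.
  by rewrite big_nil.
rewrite big_cons -IH -pdD.
- by congr (pd k _ p); apply/funext => q; rewrite big_cons.
- exact: smooth_drv (sF i) Op.
- exact: smooth_drv (smooth_sum _ oO sF) Op.
Qed.

(** The flat Laplacian of R^4 in the coordinates of a chart; the Kaehler metric does not enter. *)
Definition lap f p : R := \sum_(k : dir) pd k (pd k f) p.

Lemma pd2D O k f g p : open O -> smooth_on O f -> smooth_on O g -> O p ->
  pd k (pd k (fun q => f q + g q)) p = pd k (pd k f) p + pd k (pd k g) p.
Proof.
move=> oO sf sg Op.
rewrite -pdD; [|exact: smooth_drv (smooth_pd k sf) Op|exact: smooth_drv (smooth_pd k sg) Op].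
apply: near_eq_pd; apply: filterS (near_open oO Op) => q Oq.
move=> /=; apply: pdD; [exact: smooth_drv sf Oq|exact: smooth_drv sg Oq].
Qed.

Lemma pd2M O k f g p : open O -> smooth_on O f -> smooth_on O g -> O p ->
  pd k (pd k (fun q => f q * g q)) p =
  f p * pd k (pd k g) p + 2 * (pd k f p * pd k g p) + g p * pd k (pd k f) p.
Proof.
move=> oO sf sg Op.
have sf1 := smooth_pd k sf; have sg1 := smooth_pd k sg.
have -> : pd k (pd k (fun q => f q * g q)) p =
          pd k (fun q => f q * pd k g q + g q * pd k f q) p.
  apply: near_eq_pd; apply: filterS (near_open oO Op) => q Oq.
  exact: pdM (smooth_drv sf Oq) (smooth_drv sg Oq).
rewrite pdD; [|exact: smooth_drv (smoothM oO sf sg1) Op|exact: smooth_drv (smoothM oO sg sf1) Op].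
rewrite (pdM (smooth_drv sf Op) (smooth_drv sg1 Op)).
rewrite (pdM (smooth_drv sg Op) (smooth_drv sf1 Op)).
move: (f p) (g p) (pd k f p) (pd k g p) (pd k (pd k f) p) (pd k (pd k g) p).
by move=> a b c d e e'; ring.
Qed.

Lemma lapD O f g p : open O -> smooth_on O f -> smooth_on O g -> O p ->
  lap (fun q => f q + g q) p = lap f p + lap g p.
Proof.
move=> oO sf sg Op; rewrite /lap -big_split; apply: eq_bigr => k _ /=.
exact: pd2D sf sg Op.
Qed.

Lemma pd2Z O (c : R) k f p : open O -> smooth_on O f -> O p ->
  pd k (pd k (fun q => c * f q)) p = c * pd k (pd k f) p.
Proof.
move=> oO sf Op.
rewrite (pd2M k oO (smooth_cst c) sf Op) pd_cst mul0r mulr0 addr0.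
have -> : pd k (fun=> c) = fun=> 0 :> R by apply/funext => q; exact: pd_cst.
by rewrite pd_cst mulr0 addr0.
Qed.

Lemma lapZ O (c : R) f p : open O -> smooth_on O f -> O p ->
  lap (fun q => c * f q) p = c * lap f p.
Proof.
move=> oO sf Op; rewrite /lap mulr_sumr; apply: eq_bigr => k _ /=.
exact: pd2Z sf Op.
Qed.

Lemma lapB O f g p : open O -> smooth_on O f -> smooth_on O g -> O p ->
  lap (fun q => f q - g q) p = lap f p - lap g p.
Proof.
move=> oO sf sg Op; rewrite -[lap g p]mul1r -mulNr -(lapZ _ oO sg Op).
rewrite -(lapD oO sf (smoothZ (-1) oO sg) Op); congr (lap _ p).
by apply/funext => q; rewrite mulN1r.
Qed.

Lemma pd_lap O f k p : open O -> smooth_on O f -> O p ->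
  lap (pd k f) p = pd k (lap f) p.
Proof.
move=> oO sf Op; rewrite /lap.
rewrite (pd_sum _ k oO Op) => [|i]; last by do 2 apply: smooth_pd.
apply: eq_bigr => l _.
rewrite -(pd_commute k l oO (smooth_pd l sf) Op) ?(pd_commute l k oO (smooth_pd l sf) Op).
apply: near_eq_pd; apply: filterS (near_open oO Op) => q Oq.
exact: pd_commute sf Oq.
Qed.

(* The second difference of [f] at [p] in the direction [k] is nonpositive, and it
   is a second derivative at a nearby point. *)
Lemma derive2_at_max O f p k : open O -> smooth_on O f -> O p ->
  (\forall q \near p, f q <= f p) -> pd k (pd k f) p <= 0.
Proof.
move=> oO sf Op fmax; rewrite leNgt; apply/negP => d0.
have sf1 := smooth_pd k sf; have sf2 := smooth_pd k sf1.
have [r1 r10 H1] := (continuous_normE _ _).1 (smooth_cont sf2 Op) _ d0.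
have [r2 r20 H2] := (nbhs_normE _ _).1 fmax.
have [r3 r30 H3] := (nbhs_normE _ _).1 (near_open oO Op).
pose m := Num.min r3 (Num.min r1 r2).
have m0 : 0 < m by rewrite !lt_min r10 r20 r30.
(* The double difference starts at p - s, so that it is centred at p; the points it samples have
   offset a + b - s with |a|, |b| <= s, hence lie within 3 s < m of p. *)
pose s := m / 4.
have s0 : 0 < s by rewrite divr_gt0.
have sr2 : s < r2.
  have sm : s < m by rewrite /s ltr_pdivrMr // ltr_pMr // ltr1n.
  by apply: lt_le_trans sm _; rewrite !ge_min lexx !orbT.
have v1 := norm_dirv k.
have nv (a : R) : `|a *: (dirv k : V)| <= `|a|.
  by rewrite normrZ ler_piMr.
pose p' := p - s *: dirv k.
have small (a b : R) : `|a| <= `|s| -> `|b| <= `|s| ->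
    `|p' + a *: dirv k + b *: dirv k - p| < m.
  move=> ha hb; rewrite (gtr0_norm s0) in ha hb.
  have -> : p' + a *: dirv k + b *: dirv k - p = (a + b - s) *: dirv k :> V.
    apply/eqP; rewrite subr_eq /p' scalerBl scalerDl -(addrA (p - _)) addrAC (addrC p).
    by rewrite addrAC.
  rewrite (le_lt_trans (nv _)) // (@le_lt_trans _ _ (s + s + s)) //.
    rewrite (le_trans (ler_normB _ _)) // (gtr0_norm s0) lerD2r.
    by rewrite (le_trans (ler_normD _ _)) // lerD.
  by rewrite /s; lra.
have [|c [d [hc hd E]]] := @double_difference R V f p' (dirv k) (dirv k) s.
  move=> a b ha hb; have := small a b ha hb; rewrite !lt_min => /andP[/H3 Oq _].
  by split; [exact: smooth_drv sf Oq|exact: smooth_drv sf1 Oq].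
have := small c d hc hd; rewrite !lt_min => /and3P[_ /H1 k1 _].
have D0 : 0 < pd k (pd k f) (p' + c *: dirv k + d *: dirv k).
  move: k1 d0; move: (pd k (pd k f) p) (pd k (pd k f) _) => a b.
  by rewrite ltr_norml => /andP[+ _]; rewrite ltrBrDr addNr.
have : 0 < s * s * pd k (pd k f) (p' + c *: dirv k + d *: dirv k) by rewrite !mulr_gt0.
rewrite -E subrK.
have a1 : f (p + s *: dirv k) <= f p.
  by apply: H2; rewrite addrAC subrr add0r (le_lt_trans (nv _)) // gtr0_norm.
have a2 : f p' <= f p.
  by apply: H2; rewrite /p' addrAC subrr add0r normrN (le_lt_trans (nv _)) // gtr0_norm.
rewrite ltNge => /negP[]; rewrite addrAC -addrA addrACA -opprD subr_le0.
exact: lerD.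
Qed.

(** At a maximum inside Q every second derivative is nonpositive, which contradicts a positive
    Laplacian. The boundary enters as any set [B] outside which the points of Q are interior, so
    that spheres and boundaries of cubes are treated alike. *)
Lemma strict_max_principle O (Q B : set V) w (M : R) : open O -> Q `<=` O -> compact Q ->
  smooth_on O w ->
  (forall p, Q p -> ~ B p -> nbhs p Q) ->
  (forall p, Q p -> ~ B p -> 0 < lap w p) ->
  (forall p, Q p -> B p -> w p <= M) -> forall p, Q p -> w p <= M.
Proof.
move=> oO QO cQ sw Qint lw wB p Qp.
have [||c /set_mem Qc cmax] := @compact_EVT_max V R w Q _ cQ.
- by exists p.
- by apply: continuous_in_subspaceT => q /set_mem/QO Oq; exact: smooth_cont sw Oq.
have {}cmax q : Q q -> w q <= w c by move=> Qq; apply: cmax; exact/mem_set.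
apply: le_trans (cmax p Qp) _.
have [Bc|nB] := pselect (B c); first exact: wB.
have := lw c Qc nB; rewrite ltNge => /negP[].
apply: sumr_le0 => k _; apply: derive2_at_max sw (QO _ Qc) _ => //.
by apply: filterS (Qint c Qc nB) => q; exact: cmax.
Qed.

(** The Euclidean square distance; in contrast to the norm of [V] it is smooth, and its Laplacian is
    the constant 8. *)
Definition sqdist (c p : V) : R := \sum_(k : dir) (rcoord k p - rcoord k c) ^+ 2.

Definition offset (c : V) (k : dir) (p : V) : R := rcoord k p - rcoord k c.

Lemma smooth_offset O c k : open O -> smooth_on O (offset c k).
Proof. by move=> oO; apply: smoothB => //; [exact: smooth_rcoord|exact: smooth_cst]. Qed.

Lemma pd_offset c k l p : pd k (offset c l) p = (k == l)%:R.
Proof.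
rewrite /offset pdB ?pd_cst ?subr0 ?pd_rcoord //; by have [] := rcoord_derive k l p.
Qed.

Lemma smooth_sqdist O c : open O -> smooth_on O (sqdist c).
Proof. by move=> oO; apply: smooth_sum => // k; apply: smoothM => //; exact: smooth_offset. Qed.

Lemma pd_sqdist c k p : pd k (sqdist c) p = 2 * (rcoord k p - rcoord k c).
Proof.
have oT : open [set: V] by exact: openT.
have sX l : smooth_on setT (offset c l) by exact: smooth_offset.
have -> : pd k (sqdist c) p = \sum_(l : dir) pd k (fun q => offset c l q * offset c l q) p.
  by rewrite -(@pd_sum _ _ _ _ k p oT I (fun l => smoothM oT (sX l) (sX l))).
rewrite (bigD1 k) //= big1 ?addr0 => [|l lk].
  rewrite (pdM (smooth_drv (sX k) I) (smooth_drv (sX k) I)) pd_offset eqxx mulr1 /offset; ring.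
rewrite (pdM (smooth_drv (sX l) I) (smooth_drv (sX l) I)) pd_offset eq_sym (negbTE lk).
by rewrite mulr0 addr0.
Qed.

Lemma pd2_sqdist c k p : pd k (pd k (sqdist c)) p = 2.
Proof.
have -> : pd k (sqdist c) = fun p => 2 * offset c k p by apply/funext => q; exact: pd_sqdist.
rewrite pdZ ?pd_offset ?eqxx ?mulr1 //.
exact: smooth_drv (smooth_offset c k openT) I.
Qed.

Lemma sum_dir (F : dir -> R) :
  \sum_(k : dir) F k = F (0, false) + F (0, true) + F (1, false) + F (1, true).
Proof.
transitivity (\sum_(i < 2) \sum_(b : bool) F (i, b)).
  by rewrite pair_bigA; apply: eq_bigr => -[].
rewrite !big_ord_recl big_ord0 !big_bool /=.
rewrite (_ : lift _ _ = 1); last by apply/val_inj.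
by ring.
Qed.

Lemma lap_sqdist c p : lap (sqdist c) p = 8.
Proof. by rewrite /lap sum_dir !pd2_sqdist; ring. Qed.

Lemma sqdist_ge0 c p : 0 <= sqdist c p.
Proof. by apply: sumr_ge0 => k _; exact: sqr_ge0. Qed.

(** Adding a small multiple of [sqdist 0] makes the Laplacian strictly positive. The coefficient is
    chosen so that the perturbation is at most e on the compact set Q, and e is arbitrary. *)
Lemma max_principle O (Q B : set V) w (M : R) : open O -> Q `<=` O -> compact Q ->
  smooth_on O w ->
  (forall p, Q p -> ~ B p -> nbhs p Q) ->
  (forall p, Q p -> ~ B p -> 0 <= lap w p) ->
  (forall p, Q p -> B p -> w p <= M) -> forall p, Q p -> w p <= M.
Proof.
move=> oO QO cQ sw Qint lw wB p Qp.
have sE := smooth_sqdist 0 oO.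
have [||d _ dmax] := @compact_EVT_max V R (sqdist 0) Q _ cQ.
- by exists p.
- by apply: continuous_in_subspaceT => q /set_mem/QO Oq; exact: smooth_cont sE Oq.
have {}dmax q : Q q -> sqdist 0 q <= sqdist 0 d by move=> Qq; apply: dmax; exact/mem_set.
apply/ler_addgt0Pr => e e0.
pose a := e / (sqdist 0 d + 1).
have s1 : 0 < sqdist 0 d + 1 by rewrite ltr_wpDl // sqdist_ge0.
have a0 : 0 < a by rewrite divr_gt0.
have aE q : Q q -> a * sqdist 0 q <= e.
  move=> Qq; rewrite /a mulrAC ler_pdivrMr // ler_pM2l // (le_trans (dmax _ Qq)) //.
  by rewrite lerDl.
have := @strict_max_principle O Q B (fun q => w q + a * sqdist 0 q) (M + e) oO QO cQ.
have sa := smoothZ a oO sE.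
move=> /(_ (smoothD oO sw sa) Qint) H.
apply: (@le_trans _ _ (w p + a * sqdist 0 p)).
  by rewrite lerDl mulr_ge0 ?sqdist_ge0 // ltW.
apply: (H _ _ p Qp) => q Qq Bq.
  rewrite (lapD oO sw sa (QO _ Qq)) (lapZ a oO sE (QO _ Qq)) lap_sqdist.
  by rewrite ltr_wpDl ?lw // mulr_gt0.
by rewrite lerD ?wB ?aE.
Qed.

Lemma compact_cube (c : V) (r : R) : compact [set p : V | `|p - c| <= r].
Proof.
pose I (x : R) : set R := `[x - r, x + r]%classic.
have cI x : compact (I x) by exact: segment_compact.
have -> : [set p : V | `|p - c| <= r] = (I c.1.1 `*` I c.1.2) `*` (I c.2.1 `*` I c.2.2).
  apply/seteqP; split => -[[p1 p2] [p3 p4]]; case: c => -[c1 c2] [c3 c4] /=;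
    rewrite !prod_normE /= !ge_max /I /= !in_itv /= !ler_distl.
    by move=> /andP[/andP[-> ->] /andP[-> ->]].
  by move=> [[-> ->] [-> ->]].
by do !apply: compact_setX.
Qed.

End Laplacian.

(** * Bernstein's gradient estimate for harmonic functions *)

Section Bernstein.
Context {R : realType}.
Local Notation V := (C2 R).
Implicit Types (O : set V) (f g : V -> R) (p : V).

Lemma sum_dir_affine (a b c d e : R) (F1 F2 F3 F4 : dir -> R) :
  \sum_(l : dir) (a * F1 l + b * F2 l + c * F3 l - d * F4 l - e) =
  a * (\sum_(l : dir) F1 l) + b * (\sum_(l : dir) F2 l) +
  c * (\sum_(l : dir) F3 l) - d * (\sum_(l : dir) F4 l) - 4 * e.
Proof. by rewrite !sum_dir; ring. Qed.

(* The difference of the two sides is [2 (e G1 - 4 x G)^2]. *)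
Lemma bernstein_square (e x G G1 G2 H H1 H2 r : R) :
  2 * e ^+ 2 * G * G2 + 26 * r ^+ 2 * H * H2 + 26 * r ^+ 2 * H1 ^+ 2
    - 24 * G ^+ 2 * x ^+ 2 - 4 * e * G ^+ 2 <=
  e * e * (G * G2 + 2 * (G1 * G1) + G * G2)
    + 2 * ((e * (- 2 * x) + e * (- 2 * x)) * (G * G1 + G * G1))
    + G * G * (e * - 2 + 2 * (- 2 * x * (- 2 * x)) + e * - 2)
    + 13 * r ^+ 2 * (H * H2 + 2 * (H1 * H1) + H * H2).
Proof.
rewrite -subr_ge0 [X in 0 <= X](_ : _ = 2 * (e * G1 - 4 * x * G) ^+ 2); last by ring.
by rewrite mulr_ge0 // sqr_ge0.
Qed.

(** Here [S1] and [S2] stand for the Laplacians of g and h, which vanish; no sign of their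
    coefficients is available. *)
Lemma sum_affine_ge0 (a b c S1 S2 : R) : S1 = 0 -> S2 = 0 ->
  forall d e : R, 0 <= c - d - e -> 0 <= a * S1 + b * S2 + c - d - e.
Proof. by move=> -> -> d e; rewrite !mulr0 !add0r. Qed.

(* Bernstein's method: with [eta = r^2 - |p - c|^2], the function
   [eta^2 (pd k h)^2 + 13 r^2 h^2] is subharmonic, and [eta] vanishes on the
   sphere. *)
Lemma gradient_estimate O h (c : V) (r M : R) : open O -> 0 < r ->
  (forall p, sqdist c p <= r ^+ 2 -> O p) -> smooth_on O h ->
  (forall p, O p -> lap h p = 0) ->
  (forall p, sqdist c p <= r ^+ 2 -> `|h p| <= M) ->
  forall k, r ^+ 2 * pd k h c ^+ 2 <= 13 * M ^+ 2.
Proof.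
move=> oO r0 BO sh lh hM k.
pose Q := [set p | sqdist c p <= r ^+ 2].
pose B := [set p | sqdist c p = r ^+ 2].
pose g := pd k h.
have sg : smooth_on O g := smooth_pd k sh.
have lg p : O p -> lap g p = 0.
  move=> Op; rewrite /g (pd_lap k oO sh Op) -[RHS](pd_cst k 0 p); apply: near_eq_pd.
  by apply: filterS (near_open oO Op) => q; exact: lh.
pose eta p := r ^+ 2 - sqdist c p.
have sE := smooth_sqdist c oO.
have seta : smooth_on O eta by exact: (smoothB oO (smooth_cst (r ^+ 2)) sE).
have ee := smoothM oO seta seta; have gg := smoothM oO sg sg; have hh := smoothM oO sh sh.
pose w p := (eta p * eta p) * (g p * g p) + 13 * r ^+ 2 * (h p * h p).
have s1 := smoothM oO ee gg; have s2 := smoothZ (13 * r ^+ 2) oO hh.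
have sw : smooth_on O w by exact: smoothD.
have pdeta l p : O p -> pd l eta p = - 2 * (rcoord l p - rcoord l c).
  move=> Op; rewrite pdB ?pd_cst ?pd_sqdist ?sub0r ?mulNr //.
  exact: smooth_drv sE Op.
have pd2eta l p : O p -> pd l (pd l eta) p = - 2.
  move=> Op.
  have -> : pd l (pd l eta) p = pd l (fun q => - 2 * offset c l q) p.
    by apply: near_eq_pd; apply: filterS (near_open oO Op) => q; exact: pdeta.
  by rewrite (pdZ _ (smooth_drv (smooth_offset c l openT) I)) pd_offset eqxx mulr1.
have E0 p : sqdist c p = \sum_(l : dir) (rcoord l p - rcoord l c) ^+ 2 by [].
have lw p : Q p -> 0 <= lap w p.
  move=> Qp; have Op := BO p Qp.
  have pdw l : 2 * eta p ^+ 2 * g p * pd l (pd l g) p + 26 * r ^+ 2 * h p * pd l (pd l h) p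
      + 26 * r ^+ 2 * pd l h p ^+ 2 - 24 * g p ^+ 2 * (rcoord l p - rcoord l c) ^+ 2
      - 4 * eta p * g p ^+ 2 <= pd l (pd l w) p.
    rewrite (pd2D l oO s1 s2 Op) (pd2M l oO ee gg Op) (pd2M l oO seta seta Op).
    rewrite (pd2M l oO sg sg Op) (pd2Z _ l oO hh Op) (pd2M l oO sh sh Op).
    rewrite (pdM (smooth_drv seta Op) (smooth_drv seta Op)).
    rewrite (pdM (smooth_drv sg Op) (smooth_drv sg Op)) (pdeta l p Op) (pd2eta l p Op).
    exact: bernstein_square.
  have gh : g p ^+ 2 <= \sum_(l : dir) pd l h p ^+ 2.
    rewrite (bigD1 k) //= lerDl; apply: sumr_ge0 => l _; exact: sqr_ge0.
  apply: le_trans (ler_sum _ (fun l _ => pdw l)); rewrite sum_dir_affine.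
  have Lg : \sum_(l : dir) pd l (pd l g) p = 0 := lg p Op.
  have Lh : \sum_(l : dir) pd l (pd l h) p = 0 := lh p Op.
  apply: (sum_affine_ge0 _ _ Lg Lh); rewrite -E0 {Lg Lh}.
  move: gh Qp; rewrite /Q /= /eta.
  have := sqdist_ge0 c p.
  move: (\sum_(_ : dir) _) (sqdist c p) (g p) => S E G E1 GS Er.
  apply: (@le_trans _ _ (26 * r ^+ 2 * G ^+ 2 - 24 * G ^+ 2 * E
      - 4 * (4 * (r ^+ 2 - E) * G ^+ 2))); last first.
    by rewrite !lerB // ler_wpM2l // mulr_ge0 // sqr_ge0.
  (* With c in place of 13 this would be G^2 ((2 c - 16) r^2 - 8 E), which is nonnegative for E <=
     r^2 as soon as c >= 12. *)
  have -> : 26 * r ^+ 2 * G ^+ 2 - 24 * G ^+ 2 * E - 4 * (4 * (r ^+ 2 - E) * G ^+ 2) =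
     G ^+ 2 * (8 * (r ^+ 2 - E) + 2 * r ^+ 2) by ring.
  by rewrite mulr_ge0 ?sqr_ge0 // addr_ge0 // mulr_ge0 // ?sqr_ge0 // subr_ge0.
have QO : Q `<=` O by move=> p; exact: BO.
have contE : continuous (sqdist c).
  by move=> p; exact: smooth_cont (smooth_sqdist c openT) I.
have cQ : compact Q.
  apply: (@subclosed_compact _ Q [set p : V | `|p - c| <= r] _ (@compact_cube R c r)).
    rewrite (_ : Q = sqdist c @^-1` [set x | x <= r ^+ 2]) //.
    by apply: preimage_closed; [move=> ? _; exact: contE|exact: closed_le].
  move=> p /= Qp; apply: norm_le_rcoord => l.
  rewrite rcoordB -[leRHS](ger0_norm (ltW r0)) -ler_sqr ?nnegrE // !real_normK ?num_real //.
  apply: le_trans Qp; rewrite /sqdist (bigD1 l) //= lerDl.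
  by apply: sumr_ge0 => j _; exact: sqr_ge0.
have Qint p : Q p -> ~ B p -> nbhs p Q.
  move=> Qp nB; have Er : sqdist c p < r ^+ 2 by rewrite lt_neqAle Qp andbT; apply/eqP.
  have e0 : 0 < r ^+ 2 - sqdist c p by rewrite subr_gt0.
  have [d d0 H] := (continuous_normE _ _).1 (contE p) _ e0.
  apply/nbhs_normE; exists d => // q /H; rewrite ltr_norml => /andP[_].
  by rewrite ltrD2r; exact: ltW.
have wB p : Q p -> B p -> w p <= 13 * r ^+ 2 * M ^+ 2.
  move=> Qp; rewrite /B /w /eta /= => ->; rewrite subrr !mul0r add0r.
  have hM2 : h p * h p <= M ^+ 2.
    rewrite -expr2 -(real_normK (num_real (h p))).
    by rewrite ler_sqr ?nnegrE // ?hM // (le_trans _ (hM p Qp)).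
  by rewrite ler_wpM2l // mulr_ge0 // sqr_ge0.
have Ec : sqdist c c = 0 by rewrite E0 big1 // => l _; rewrite subrr expr0n.
have Qc : Q c by rewrite /Q /= Ec sqr_ge0.
have := max_principle oO QO cQ sw Qint (fun p Qp _ => lw p Qp) wB Qc.
(* At the centre [eta] equals r^2, so r^4 (g c)^2 <= w c <= 13 r^2 M^2, and one factor r^2
   cancels. *)
rewrite /w /eta Ec subr0 -/g => wc.
have r2 : 0 < r ^+ 2 by rewrite exprn_gt0.
rewrite -(ler_pM2l r2).
apply: (@le_trans _ _ (13 * r ^+ 2 * M ^+ 2)); last by rewrite [leRHS]mulrCA [leRHS]mulrA.
have -> : r ^+ 2 * (r ^+ 2 * g c ^+ 2) = r ^+ 2 * r ^+ 2 * (g c * g c).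
  by rewrite (expr2 (g c)) mulrA.
apply: le_trans wc; rewrite lerDl.
by apply: mulr_ge0; [rewrite mulr_ge0 // sqr_ge0|rewrite -expr2 sqr_ge0].
Qed.

End Bernstein.

(** * Locally uniform limits of harmonic functions *)

Section HarmonicConvergence.
Context {R : realType}.
Local Notation V := (C2 R).
Implicit Types (O G : set V) (hs : nat -> V -> R) (p q : V).

Lemma cvg_le_bound (u : nat -> R) (l b : R) (N : nat) : u n @[n --> \oo] --> l ->
  (forall n, (N <= n)%N -> u n <= b) -> l <= b.
Proof.
move=> ul H; apply: (@closed_cvg _ _ \oo _ u (fun x : R => x <= b) _ _ l ul); first exact: closed_le.
by exists N => // n /= Nn; exact: H.
Qed.

(** A Cauchy condition, since inside the cubes no limit is known beforehand. The bound is not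
    strict, so it survives the passage to the limit in one index. *)
Definition ucauchy (S : set V) hs := forall e : R, 0 < e ->
  exists N, forall n m, (N <= n)%N -> (N <= m)%N -> forall p, S p -> `|hs n p - hs m p| <= e.

Definition lucauchy (G : set V) hs := forall p, G p ->
  exists2 r : R, 0 < r & ucauchy [set q | `|q - p| < r] hs.

Definition harmonic_on O (f : V -> R) := smooth_on O f /\ forall p, O p -> lap f p = 0.

Lemma ucauchyW S S' hs : S' `<=` S -> ucauchy S hs -> ucauchy S' hs.
Proof.
move=> SS H e /H[N HN]; exists N => n m nN mN p /SS; exact: HN.
Qed.

Lemma harmonicB O f g : open O -> harmonic_on O f -> harmonic_on O g ->
  harmonic_on O (fun p => f p - g p).
Proof.
move=> oO [sf lf] [sg lg]; split; first exact: smoothB.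
by move=> p Op; rewrite (lapB oO sf sg Op) (lf p Op) (lg p Op) subrr.
Qed.

Lemma harmonic_pd O f k : open O -> harmonic_on O f -> harmonic_on O (pd k f).
Proof.
move=> oO [sf lf]; split; first exact: smooth_pd.
move=> p Op; rewrite (pd_lap k oO sf Op) -[RHS](pd_cst k 0 p); apply: near_eq_pd.
by apply: filterS (near_open oO Op) => q; exact: lf.
Qed.

Lemma harmonic_boundary O (Q B : set V) f (M : R) : open O -> Q `<=` O -> compact Q ->
  (forall p, Q p -> ~ B p -> nbhs p Q) -> harmonic_on O f ->
  (forall p, Q p -> B p -> `|f p| <= M) -> forall p, Q p -> `|f p| <= M.
Proof.
move=> oO QO cQ Qint [sf lf] fB p Qp; rewrite ler_norml; apply/andP; split; last first.
  apply: (max_principle oO QO cQ sf Qint _ _ Qp) => q Qq Bq.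
    by rewrite (lf q (QO _ Qq)).
  exact: le_trans (ler_norm _) (fB q Qq Bq).
rewrite lerNl -mulN1r.
apply: (max_principle oO QO cQ (smoothZ (-1) oO sf) Qint _ _ Qp) => q Qq Bq.
  by rewrite (lapZ _ oO sf (QO _ Qq)) (lf q (QO _ Qq)) mulr0.
by rewrite mulN1r; apply: le_trans (ler_norm _) _; rewrite normrN; exact: fB.
Qed.

(** The differences of two members are harmonic and thus bounded on Q by their bound on the
    boundary. Nothing is asked of the sequence at the interior points beyond harmonicity, so a
    bubbling point is allowed there. *)
Lemma ucauchy_boundary O (Q B : set V) hs : open O -> Q `<=` O -> compact Q ->
  (forall p, Q p -> ~ B p -> nbhs p Q) -> (forall n, harmonic_on O (hs n)) ->
  ucauchy (Q `&` B) hs -> ucauchy Q hs.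
Proof.
move=> oO QO cQ Qint hh uB e e0; have [N HN] := uB e e0.
exists N => n m nN mN; apply: (harmonic_boundary oO QO cQ Qint).
  exact: harmonicB.
by move=> p Qp Bp; apply: HN.
Qed.

Lemma sqdist_le_norm c p (r : R) : 0 <= r -> sqdist c p <= r ^+ 2 -> `|p - c| <= r.
Proof.
move=> r0 H; apply: norm_le_rcoord => l.
rewrite rcoordB -[leRHS](ger0_norm r0) -ler_sqr ?nnegrE // !real_normK ?num_real //.
apply: le_trans H; rewrite /sqdist (bigD1 l) //= lerDl.
by apply: sumr_ge0 => j _; exact: sqr_ge0.
Qed.

(** The gradient estimate is applied to the differences of two members on balls of a fixed radius
    [s], centred at any point within [s] of p. *)
Lemma lucauchy_pd G hs k : open G -> (forall n, harmonic_on G (hs n)) ->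
  lucauchy G hs -> lucauchy G (fun n => pd k (hs n)).
Proof.
move=> oG hh lu p Gp; have [r1 r10 u1] := lu p Gp.
have [r2 r20 H2] := (nbhs_normE _ _).1 (near_open oG Gp).
pose r := Num.min r1 r2.
have r0 : 0 < r by rewrite lt_min r10 r20.
pose s := r / 2.
have s0 : 0 < s by rewrite divr_gt0.
exists s => // e e0.
(* The estimate turns a bound e s / 4 on the difference into 13 e^2 / 16 <= e^2 for the squared
   derivative. *)
have [N HN] := u1 (e * s / 4) (divr_gt0 (mulr_gt0 e0 s0) (ltr0n R 4)).
exists N => n m nN mN q /= qp.
have small x : sqdist q x <= s ^+ 2 -> `|x - p| < r.
  move=> /(sqdist_le_norm (ltW s0)) xq.
  rewrite (le_lt_trans (ler_distD q _ _)) // (splitr r).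
  exact: ler_ltD.
have sG x : sqdist q x <= s ^+ 2 -> G x.
  by move=> /small; rewrite lt_min => /andP[_ /H2].
have [sf lf] := harmonicB oG (hh n) (hh m).
have Gq : G q.
  by apply: H2; apply: lt_le_trans qp _; rewrite /s ler_pdivrMr // (le_trans (_ : r <= r2)) ?ge_min ?lexx ?orbT // ler_peMr ?ler1n // ltW.
have hM x : sqdist q x <= s ^+ 2 -> `|hs n x - hs m x| <= e * s / 4.
  by move=> /small; rewrite lt_min => /andP[xr _]; apply: HN.
have := gradient_estimate oG s0 sG sf lf hM k.
rewrite (pdB (smooth_drv (hh n).1 Gq) (smooth_drv (hh m).1 Gq)).
move: (pd k (hs n) q - _) => D H.
rewrite -[leRHS](ger0_norm (ltW e0)) -ler_sqr ?nnegrE // !real_normK ?num_real //.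
rewrite -(ler_pM2l (exprn_gt0 2 s0)); apply: le_trans H _.
have -> : 13 * (e * s / 4) ^+ 2 = s ^+ 2 * e ^+ 2 * (13 / 16) by field.
by rewrite ger_pMr ?mulr_gt0 ?exprn_gt0 // ler_pdivrMr // mul1r ler_nat.
Qed.

Lemma cauchy_pointwise S hs p : ucauchy S hs -> S p -> cvg (hs n p @[n --> \oo]).
Proof.
move=> uS Sp; apply/cauchy_cvgP/cauchy_exP => e e0.
have [N HN] := uS (e / 2) (divr_gt0 e0 (ltr0n R 2)).
exists (hs N p); exists N => // n /= Nn; rewrite -ball_normE /=.
by rewrite (le_lt_trans (HN N n _ _ p Sp)) // ltr_pdivrMr // ltr_pMr // ltr1n.
Qed.

Lemma ucauchy_lim S hs f : ucauchy S hs ->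
  (forall p, S p -> hs n p @[n --> \oo] --> f p) ->
  forall e : R, 0 < e -> exists N, forall n, (N <= n)%N -> forall p, S p -> `|hs n p - f p| <= e.
Proof.
move=> uS hf e e0; have [N HN] := uS e e0; exists N => n Nn p Sp.
have : `|hs n p - hs m p| @[m --> \oo] --> `|hs n p - f p|.
  by apply: cvg_norm; apply: cvgB; [exact: cvg_cst|exact: hf].
by move=> /(@cvg_le_bound _ _ e N); apply=> m Nm; exact: HN.
Qed.

Lemma lucauchy_continuous G hs f : lucauchy G hs ->
  (forall n p, G p -> {for p, continuous (hs n)}) ->
  (forall p, G p -> hs n p @[n --> \oo] --> f p) -> open G ->
  forall p, G p -> {for p, continuous f}.
Proof.
move=> lu ch hf oG p Gp; apply/continuous_normE => e e0.
have [r1 r10 u1] := lu p Gp.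
have [r2 r20 H2] := (nbhs_normE _ _).1 (near_open oG Gp).
have e3 : 0 < e / 4 by rewrite divr_gt0.
have u2 : ucauchy [set q | `|q - p| < Num.min r1 r2] hs.
  by apply: ucauchyW u1 => q /=; rewrite lt_min => /andP[].
have [|N HN] := ucauchy_lim (f := f) u2 _ e3.
  by move=> q /=; rewrite lt_min => /andP[_ /H2]; exact: hf.
have [r3 r30 H3] := (continuous_normE _ _).1 (ch N p Gp) _ e3.
exists (Num.min r3 (Num.min r1 r2)) => [|q]; first by rewrite !lt_min r10 r20 r30.
rewrite lt_min => /andP[/H3 q3 q12].
have qN := HN N (leqnn N) q q12.
have pN := HN N (leqnn N) p; rewrite /= subrr normr0 lt_min r10 r20 in pN.
have {}pN := pN isT.
move: q3 qN pN; rewrite distrC.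
move: (f q) (f p) (hs N q) (hs N p) => a b c d.
rewrite !ler_norml !ltr_norml => /andP[? ?] /andP[? ?] /andP[? ?]; apply/andP; split; lra.
Qed.

(** Exchange of limit and derivative. The mean value theorem bounds the increments of hs N - hs m by
    |t| e / 4 uniformly in m, so m can go to infinity with N fixed; the step t is taken small for
    this one N. *)
Lemma lucauchy_derive G hs f g k : open G -> (forall n, smooth_on G (hs n)) ->
  (forall p, G p -> hs n p @[n --> \oo] --> f p) ->
  (forall p, G p -> pd k (hs n) p @[n --> \oo] --> g p) ->
  lucauchy G (fun n => pd k (hs n)) ->
  forall p, G p -> is_derive p (dirv k) f (g p).
Proof.
move=> oG sh hf hg lu p Gp.
suff E : (fun t : R => t^-1 *: ((f \o shift p) (t *: dirv k) - f p)) @ 0^' --> g p.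
  by split; [apply/cvg_ex; exists (g p)|exact: cvg_lim E].
apply/cvgrPdist_le => e e0.
have [r1 r10 u1] := lu p Gp.
have [r2 r20 H2] := (nbhs_normE _ _).1 (near_open oG Gp).
pose r := Num.min r1 r2.
have r0 : 0 < r by rewrite lt_min r10 r20.
have e3 : 0 < e / 4 by rewrite divr_gt0.
have [N1 HN1] := u1 _ e3.
have u2 : ucauchy [set p] (fun n => pd k (hs n)).
  by apply: ucauchyW u1 => q -> /=; rewrite subrr normr0.
have [|N2 HN2] := ucauchy_lim (f := g) u2 _ e3; first by move=> q ->; exact: hg.
pose N := maxn N1 N2.
have N1N : (N1 <= N)%N by exact: leq_maxl.
have dN : (fun t : R => t^-1 *: ((hs N \o shift p) (t *: dirv k) - hs N p)) @ 0^' -->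
    pd k (hs N) p by have := smooth_drv (k := k) (sh N) Gp.
move/cvgrPdist_le : dN => /(_ _ e3) dN.
near=> t.
have t0 : t != 0 by near: t; exact: nbhs_dnbhs_neq.
have tr : `|t| < r.
  near: t; apply: nbhs_dnbhs; apply/nbhs_ballP; exists r => //= x.
  by rewrite -ball_normE /= sub0r normrN.
have dNt : `|pd k (hs N) p - t^-1 *: ((hs N \o shift p) (t *: dirv k) - hs N p)| <= e / 4.
  by near: t; exact: dN.
have inr (s : R) : `|s| <= `|t| -> `|p + s *: dirv k - p| < r.
  move=> st; rewrite addrAC subrr add0r normrZ.
  apply: le_lt_trans tr; apply: le_trans st.
  by rewrite ler_piMr // norm_dirv.
have Gs (s : R) : `|s| <= `|t| -> G (p + s *: dirv k).
  by move=> /inr; rewrite lt_min => /andP[_ /H2].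
have D m : (N <= m)%N ->
    `|(hs N (p + t *: dirv k) - hs m (p + t *: dirv k)) - (hs N p - hs m p)| <= `|t| * (e / 4).
  move=> Nm.
  have [|c ct ->] := @mean_value_line R V (fun q => hs N q - hs m q) p (dirv k) t.
    by move=> s st; apply: derivableB; [exact: smooth_drv (sh N) (Gs s st)|exact: smooth_drv (sh m) (Gs s st)].
  rewrite normrM ler_wpM2l //.
  rewrite -/(pd k (fun q => hs N q - hs m q) _).
  rewrite (pdB (smooth_drv (sh N) (Gs c ct)) (smooth_drv (sh m) (Gs c ct))).
  apply: HN1 => //=; first exact: leq_trans Nm.
  by have := inr c ct; rewrite lt_min => /andP[].
have {}D : `|(hs N (p + t *: dirv k) - f (p + t *: dirv k)) - (hs N p - f p)| <= `|t| * (e / 4).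
  have : `|(hs N (p + t *: dirv k) - hs m (p + t *: dirv k)) - (hs N p - hs m p)| @[m --> \oo]
      --> `|(hs N (p + t *: dirv k) - f (p + t *: dirv k)) - (hs N p - f p)|.
    apply: cvg_norm; apply: cvgB; apply: cvgB; [exact: cvg_cst| |exact: cvg_cst|exact: hf].
    exact/hf/Gs.
  by move=> /(@cvg_le_bound _ _ (`|t| * (e / 4)) N); apply=> m; exact: D.
have gN : `|pd k (hs N) p - g p| <= e / 4 by apply: HN2 => //; exact: leq_maxr.
rewrite /= (addrC _ p); rewrite /= (addrC _ p) in dNt.
move: dNt D gN; move: (pd k (hs N) p) (hs N _) (f _) (hs N p) (f p) (g p) => A B C D' E' F.
move=> h1 h2 h3.
have h4 : `|t^-1 *: (B - D') - t^-1 *: (C - E')| <= e / 4.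
  rewrite -scalerBr normrZ normfV ler_pdivrMl ?normr_gt0 //.
  by rewrite (_ : B - D' - (C - E') = B - C - (D' - E')) //; ring.
move: h1 h3 h4; move: (t^-1 *: _) (t^-1 *: _) => a b.
rewrite !ler_norml => /andP[? ?] /andP[? ?] /andP[? ?]; apply/andP; split; lra.
Unshelve. all: by end_near. Qed.

(** The derivatives along k again form a locally uniformly Cauchy sequence of harmonic functions,
    and they converge to the derivative of f. Hence the induction on the order of smoothness runs
    over all sequences together with their limits. *)
Lemma harmonic_limit G hs f : open G -> (forall n, harmonic_on G (hs n)) ->
  lucauchy G hs -> (forall p, G p -> hs n p @[n --> \oo] --> f p) ->
  smooth_on G f /\ forall k p, G p -> pd k (hs n) p @[n --> \oo] --> pd k f p.
Proof.
move=> oG hh lu hf.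
have key h' f' : (forall n, harmonic_on G (h' n)) -> lucauchy G h' ->
    (forall p, G p -> h' n p @[n --> \oo] --> f' p) ->
    forall k, (forall p, G p -> pd k (h' n) p @[n --> \oo] --> pd k f' p) /\
    (forall p, G p -> derivable f' p (dirv k)).
  move=> hh' lu' hf' k; have lk := lucauchy_pd k oG hh' lu'.
  pose g p := lim (pd k (h' n) p @[n --> \oo]).
  have hg p : G p -> pd k (h' n) p @[n --> \oo] --> g p.
    move=> Gp; have [r r0 u] := lk p Gp; apply: (cauchy_pointwise u).
    by rewrite /= subrr normr0.
  have dg := lucauchy_derive oG (fun n => (hh' n).1) hf' hg lk.
  split=> p Gp; last by have [] := dg p Gp.
  by have [_] := dg p Gp; rewrite -/(pd k f' p) => ->; exact: hg.
split; last by move=> k; have [] := key _ _ hh lu hf k.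
apply/smooth_ksmooth => n; elim: n hs f hh lu hf => [|n IH] hs f hh lu hf.
all: have c0 p : G p -> {for p, continuous f} /\ forall k, derivable f p (dirv k)
  by move=> Gp; split=> [|k]; [exact: (lucauchy_continuous lu (fun n q => smooth_cont (hh n).1) hf)
    |exact: (key _ _ hh lu hf k).2].
all: split=> [//|//]; move=> k.
apply: (IH (fun n => pd k (hs n))); [move=> m; exact: harmonic_pd|exact: lucauchy_pd|].
exact: (key _ _ hh lu hf k).1.
Qed.

End HarmonicConvergence.

(** * The chain rule in the four real coordinates *)

Section ChainRule.
Context {R : realType}.
Local Notation V := (C2 R).
Implicit Types (O : set V) (f : V -> R) (p q h : V).

Definition coord_step (h : V) (k : dir) : V := rcoord k h *: dirv k.

Lemma coord_stepE h : h = coord_step h (0, false) + coord_step h (0, true)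
  + coord_step h (1, false) + coord_step h (1, true).
Proof.
apply/eqP; rewrite -subr_eq0 -normr_le0; apply: norm_le_rcoord => k.
rewrite normr_le0 rcoordB subr_eq0 !rcoordD !rcoordZ !rcoord_dirv; apply/eqP.
case: k => -[[|[|m]] im] b //.
  rewrite (_ : Ordinal im = 0); last exact: val_inj.
  by case: b; rewrite !xpair_eqE /= ?(mulr0, mulr1, addr0, add0r).
rewrite (_ : Ordinal im = 1); last exact: val_inj.
by case: b; rewrite !xpair_eqE /= ?(mulr0, mulr1, addr0, add0r).
Qed.

Lemma continuous_components (T : V -> V) p :
  (forall l, {for p, continuous (fun x => rcoord l (T x))}) ->
  forall d, 0 < d -> exists2 r : R, 0 < r & forall x, `|x - p| < r -> `|T x - T p| < d.
Proof.
move=> cT d d0; have d2 : 0 < d / 2 by rewrite divr_gt0.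
have ex l := (continuous_normE _ _).1 (cT l) _ d2.
have [r1 r10 H1] := ex (0, false); have [r2 r20 H2] := ex (0, true).
have [r3 r30 H3] := ex (1, false); have [r4 r40 H4] := ex (1, true).
exists (Num.min (Num.min r1 r2) (Num.min r3 r4)) => [|x].
  by rewrite !lt_min r10 r20 r30 r40.
rewrite !lt_min => /andP[/andP[x1 x2] /andP[x3 x4]].
apply: (@le_lt_trans _ _ (d / 2)); last by rewrite ltr_pdivrMr // ltr_pMr // ltr1n.
apply: norm_le_rcoord => l.
rewrite rcoordB; apply: ltW.
have [j0|j1] : l.1 = 0 \/ l.1 = 1.
  by case: l => -[[|[|m]] im] b //; [left|right]; apply/val_inj.
- by case: l j0 => j [] /= ->; [exact: H2|exact: H1].
- by case: l j1 => j [] /= ->; [exact: H4|exact: H3].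
Qed.


(** One leg of an axis-parallel path. Its starting point x may be any point near q, while the
    derivative is compared with its value at q itself, because the later legs do not start at q. *)
Lemma coord_step_increment O f q (e : R) : open O -> smooth_on O f -> O q -> 0 < e ->
  exists2 d : R, 0 < d & forall k x h, `|x - q| < d -> `|h| < d ->
    `|f (x + coord_step h k) - f x - rcoord k h * pd k f q| <= e * `|rcoord k h|.
Proof.
move=> oO sf Oq e0.
have ex k : exists2 d : R, 0 < d & forall x, `|x - q| < d -> O x /\ `|pd k f x - pd k f q| < e.
  have [r1 r10 H1] := (continuous_normE _ _).1 (smooth_cont (smooth_pd k sf) Oq) _ e0.
  have [r2 r20 H2] := (nbhs_normE _ _).1 (near_open oO Oq).
  exists (Num.min r1 r2) => [|x]; first by rewrite lt_min r10 r20.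
  by rewrite lt_min => /andP[xr1 xr2]; split; [exact: H2|exact: H1].
have [d d0 H] : exists2 d : R, 0 < d & forall k x, `|x - q| < d ->
    O x /\ `|pd k f x - pd k f q| < e.
  have [d1 d10 H1] := ex (0, false); have [d2 d20 H2] := ex (0, true).
  have [d3 d30 H3] := ex (1, false); have [d4 d40 H4] := ex (1, true).
  exists (Num.min (Num.min d1 d2) (Num.min d3 d4)) => [|k x].
    by rewrite !lt_min d10 d20 d30 d40.
  rewrite !lt_min => /andP[/andP[x1 x2] /andP[x3 x4]].
  have [j0|j1] : k.1 = 0 \/ k.1 = 1.
    by case: k => -[[|[|m]] im] b //; [left|right]; apply/val_inj.
  - by case: k j0 => j [] /= ->; [exact: H2|exact: H1].
  - by case: k j1 => j [] /= ->; [exact: H4|exact: H3].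
exists (d / 2) => [|k x h xq hd]; first by rewrite divr_gt0.
have near_q (s : R) : `|s| <= `|rcoord k h| -> `|x + s *: dirv k - q| < d.
  move=> sh; rewrite addrAC (le_lt_trans (ler_normD _ _)) // (splitr d) ltrD //.
  rewrite normrZ; apply: le_lt_trans hd; apply: le_trans (rcoord_le_norm k h).
  by apply: le_trans sh; rewrite ler_piMr // norm_dirv.
have [|c ch ->] := @mean_value_line R V f x (dirv k) (rcoord k h).
  by move=> s /near_q /(H k)[Os _]; exact: smooth_drv sf Os.
rewrite -/(pd k f _) -mulrBr normrM mulrC ler_wpM2r // ltW //.
exact: (H k _ (near_q c ch)).2.
Qed.

(** Continuous partial derivatives give total differentiability: q is joined to q + h by four
    axis-parallel steps, and the errors add up. *)
Lemma first_order O f q (e : R) : open O -> smooth_on O f -> O q -> 0 < e ->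
  exists2 d : R, 0 < d & forall h, `|h| < d ->
    `|f (q + h) - f q - \sum_(k : dir) rcoord k h * pd k f q| <=
      e * \sum_(k : dir) `|rcoord k h|.
Proof.
move=> oO sf Oq e0; have [d d0 H] := coord_step_increment oO sf Oq e0.
(* Each step is shorter than d / 4, so the last one starts within 3 d / 4 of q, where the one-step
   estimate still applies. *)
exists (d / 4) => [|h hd]; first by rewrite divr_gt0.
have hs k : `|coord_step h k| < d / 4.
  rewrite normrZ; apply: le_lt_trans hd; apply: le_trans (rcoord_le_norm k h).
  by rewrite ler_piMr // norm_dirv.
have hd' : `|h| < d by apply: lt_le_trans hd _; rewrite ler_pdivrMr // ler_pMr // ler1n.
have c1 : d / 4 < d by clear -d0; lra.
have c2 : d / 4 + d / 4 < d by clear -d0; lra.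
have c3 : d / 4 + d / 4 + d / 4 < d by clear -d0; lra.
have dd : 0 < d / 4 by rewrite divr_gt0.
pose x1 := q + coord_step h (0, false).
pose x2 := x1 + coord_step h (0, true).
pose x3 := x2 + coord_step h (1, false).
have x4 : q + h = x3 + coord_step h (1, true).
  by rewrite /x3 /x2 /x1 [in LHS](coord_stepE h) !addrA.
have b1 : `|x1 - q| < d / 4 by rewrite /x1 addrAC subrr add0r.
have b2 : `|x2 - q| < d / 4 + d / 4.
  by rewrite /x2 addrAC (le_lt_trans (ler_normD _ _)) // ltrD.
have b3 : `|x3 - q| < d / 4 + d / 4 + d / 4.
  by rewrite /x3 addrAC (le_lt_trans (ler_normD _ _)) // ltrD.
have E1 := H (0, false) q h; have E2 := H (0, true) x1 h.
have E3 := H (1, false) x2 h; have E4 := H (1, true) x3 h.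
move: E1 E2 E3 E4; rewrite -/x1 -/x2 -/x3 -x4 subrr normr0 => E1 E2 E3 E4.
have {}E1 := E1 d0 hd'.
have {}E2 := E2 (lt_trans b1 c1) hd'.
have {}E3 := E3 (lt_trans b2 c2) hd'.
have {}E4 := E4 (lt_trans b3 c3) hd'.
rewrite !sum_dir.
move: E1 E2 E3 E4.
move: (f (q + h)) (f x3) (f x2) (f x1) (f q) => y4 y3 y2 y1 y0.
move: (pd (0, false) f q) (pd (0, true) f q) (pd (1, false) f q) (pd (1, true) f q) => p1 p2 p3 p4.
move: (rcoord (0, false) h) (rcoord (0, true) h) (rcoord (1, false) h) (rcoord (1, true) h) => h1 h2 h3 h4.
move=> E1 E2 E3 E4; rewrite !mulrDr.
have -> : y4 - y0 - (h1 * p1 + h2 * p2 + h3 * p3 + h4 * p4) =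
  (y1 - y0 - h1 * p1) + (y2 - y1 - h2 * p2) + (y3 - y2 - h3 * p3) + (y4 - y3 - h4 * p4) by ring.
by do 3 (apply: le_trans (ler_normD _ _) _; apply: lerD => //).
Qed.

Lemma cvg_sum_dir (F : dir -> R -> R) (L : dir -> R) :
  (forall l, F l @ 0^' --> L l) ->
  (fun t => \sum_(l : dir) F l t) @ 0^' --> \sum_(l : dir) L l.
Proof.
move=> H; rewrite sum_dir.
rewrite (_ : (fun t => _) =
  fun t => F (0, false) t + F (0, true) t + F (1, false) t + F (1, true) t).
  by do 3 (apply: cvgD; last exact: H); exact: H.
by apply/funext => t; rewrite sum_dir.
Qed.

Lemma pd_comp O f (T : V -> V) p k : open O -> smooth_on O f -> O (T p) ->
  (forall l, {for p, continuous (fun x => rcoord l (T x))}) ->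
  (forall l, derivable (fun x => rcoord l (T x)) p (dirv k)) ->
  is_derive p (dirv k) (fun x => f (T x))
    (\sum_(l : dir) pd l f (T p) * pd k (fun x => rcoord l (T x)) p).
Proof.
move=> oO sf OT cT dT.
pose D l := pd k (fun x => rcoord l (T x)) p.
pose a l := pd l f (T p).
pose q l (t : R) : R := t^-1 * (rcoord l (T (t *: dirv k + p)) - rcoord l (T p)).
have qD l : q l @ 0^' --> D l by exact: dT.
suff E : (fun t : R => t^-1 *: (((fun x => f (T x)) \o shift p) (t *: dirv k) - f (T p)))
    @ 0^' --> \sum_(l : dir) a l * D l.
  by split; [apply/cvg_ex; exists (\sum_(l : dir) a l * D l)|exact: cvg_lim E].
have S1 : (fun t => \sum_(l : dir) a l * q l t) @ 0^' --> \sum_(l : dir) a l * D l.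
  apply: cvg_sum_dir => l; apply: cvgM; [exact: cvg_cst|exact: qD].
have S2 : (fun t => \sum_(l : dir) `|q l t|) @ 0^' --> \sum_(l : dir) `|D l|.
  by apply: cvg_sum_dir => l; apply: cvg_norm; exact: qD.
apply/cvgrPdist_le => e e0.
(* For small t the difference quotients of T have absolute sum at most [B]; a first-order error of e
   / (2 B) per unit then costs e / 2. *)
pose B := \sum_(l : dir) `|D l| + 1.
have B0 : 0 < B by rewrite ltr_wpDl // sumr_ge0.
have e2 : 0 < e / 2 by rewrite divr_gt0.
have [d d0 Hd] := first_order oO sf OT (divr_gt0 e2 B0).
have [r r0 Hr] := continuous_components cT d0.
move/cvgrPdist_le : (S1) => /(_ _ e2) N1.
move/cvgrPdist_le : (S2) => /(_ _ ltr01) N2.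
near=> t.
have t0 : t != 0 by near: t; exact: nbhs_dnbhs_neq.
have tr : `|t| < r.
  near: t; apply: nbhs_dnbhs; apply/nbhs_ballP; exists r => //= x.
  by rewrite -ball_normE /= sub0r normrN.
have n1 : `|\sum_(l : dir) a l * D l - \sum_(l : dir) a l * q l t| <= e / 2.
  by near: t; exact: N1.
have n2 : `|\sum_(l : dir) `|D l| - \sum_(l : dir) `|q l t| | <= 1.
  by near: t; exact: N2.
have Td : `|T (t *: dirv k + p) - T p| < d.
  apply: Hr; rewrite addrK normrZ; apply: le_lt_trans tr.
  by rewrite ler_piMr // norm_dirv.
have := Hd _ Td; rewrite (addrC (T p)) subrK /=.
set h := T _ - T p.
have hl l : rcoord l h = t * q l t.
  by rewrite /q mulrA mulfV // mul1r /h rcoordB.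
have -> : \sum_(l : dir) rcoord l h * pd l f (T p) = t * \sum_(l : dir) a l * q l t.
  by rewrite mulr_sumr; apply: eq_bigr => l _; rewrite hl -mulrA [q l t * _]mulrC.
have -> : \sum_(l : dir) `|rcoord l h| = `|t| * \sum_(l : dir) `|q l t|.
  by rewrite mulr_sumr; apply: eq_bigr => l _; rewrite hl normrM.
move=> HH.
have n3 : `|t^-1 * (f (T (t *: dirv k + p)) - f (T p)) - \sum_(l : dir) a l * q l t| <= e / 2.
  rewrite -[X in _ - X](mulKf t0) -mulrBr normrM normfV ler_pdivrMl ?normr_gt0 //.
  apply: le_trans HH _; rewrite mulrCA ler_wpM2l //.
  rewrite -mulrA ger_pMr // ler_pdivrMl // mulr1 /B.
  move: n2; rewrite ler_norml => /andP[+ _].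
  by move: (\sum_(_ : dir) _) (\sum_(_ : dir) _) => u v; clear; lra.
rewrite /= -[_ *: _]/(_ * _); move: n1 n3.
move: (\sum_(_ : dir) _) (\sum_(_ : dir) a _ * q _ t) (t^-1 * _) => u v w.
by clear; rewrite !ler_norml => /andP[? ?] /andP[? ?]; apply/andP; split; lra.
Unshelve. all: by end_near. Qed.

Lemma ksmooth_sum n (I : Type) (s : seq I) O (F : I -> V -> R) : open O ->
  (forall i, ksmooth n O (F i)) -> ksmooth n O (fun p => \sum_(i <- s) F i p).
Proof.
move=> oO sF; elim: s => [|i s IH].
  by apply: (ksmooth_ext oO _ (ksmooth_cst n O 0)) => p _; rewrite big_nil.
by apply: (ksmooth_ext oO _ (ksmoothD oO (sF i) IH)) => p _; rewrite big_cons.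
Qed.

(** By the chain rule a derivative of the composite is a sum of products of (pd l f) o T with smooth
    functions, so the induction on the order is over all smooth f with T fixed. *)
Lemma smooth_comp O O' f (T : V -> V) : open O -> open O' -> smooth_on O f ->
  (forall p, O' p -> O (T p)) -> (forall l, smooth_on O' (fun x => rcoord l (T x))) ->
  smooth_on O' (fun x => f (T x)).
Proof.
move=> oO oO' sf OT sT; apply/smooth_ksmooth => n; elim: n f sf => [|n IH] f sf.
all: have dfT k p : O' p -> is_derive p (dirv k) (fun x => f (T x))
    (\sum_(l : dir) pd l f (T p) * pd k (fun x => rcoord l (T x)) p)
  by move=> Op; apply: (pd_comp oO sf (OT p Op)) => l;
   [exact: smooth_cont (sT l) Op|exact: smooth_drv (sT l) Op].
all: have c0 p : O' p -> {for p, continuous (fun x => f (T x))} /\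
    forall k, derivable (fun x => f (T x)) p (dirv k).
1,3: move=> Op; split=> [|k]; last by have [] := dfT k p Op.
1,2: apply/continuous_normE => e e0.
1,2: have [d d0 Hd] := (continuous_normE _ _).1 (smooth_cont sf (OT p Op)) _ e0.
1,2: have [r r0 Hr] := continuous_components (fun l => smooth_cont (sT l) Op) d0.
1,2: by exists r => // x /Hr /Hd.
all: split=> [//|//]; move=> k.
apply: (@ksmooth_ext _ _ _
  (fun p => \sum_(l : dir) pd l f (T p) * pd k (fun x => rcoord l (T x)) p) _ oO').
  by move=> p Op; have [_] := dfT k p Op; rewrite -/(pd k _ p).
apply: (ksmooth_sum _ oO') => l; apply: (ksmoothM oO'); first exact: IH (smooth_pd l sf).
by have /smooth_ksmooth := smooth_pd k (sT l); apply.
Qed.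

End ChainRule.

(** * Holomorphic functions *)

Section Holomorphic.
Context {R : realType}.
Local Notation V := (C2 R).
Local Notation C := R[i].
Implicit Types (O G : set V) (f g : V -> C) (p : V).

Lemma csmoothW O O' f : O' `<=` O -> csmooth_on O f -> csmooth_on O' f.
Proof. by move=> OO [s1 s2]; split; exact: smooth_onW OO _. Qed.

Lemma csmooth_ext O f g : open O -> (forall q, O q -> f q = g q) ->
  csmooth_on O f -> csmooth_on O g.
Proof.
by move=> oO fg [s1 s2]; split; [move: s1|move: s2]; apply: smooth_ext => // q Oq; rewrite fg.
Qed.

Lemma csmooth_cst O (c : C) : csmooth_on O (fun=> c).
Proof. by split; exact: smooth_cst. Qed.

Lemma ReD (a b : C) : complex.Re (a + b) = complex.Re a + complex.Re b.
Proof. by case: a b => [? ?] []. Qed.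

Lemma ImD (a b : C) : complex.Im (a + b) = complex.Im a + complex.Im b.
Proof. by case: a b => [? ?] []. Qed.

Lemma ReM (a b : C) : complex.Re (a * b) =
  complex.Re a * complex.Re b - complex.Im a * complex.Im b.
Proof. by case: a b => [? ?] []. Qed.

Lemma ImM (a b : C) : complex.Im (a * b) =
  complex.Re a * complex.Im b + complex.Im a * complex.Re b.
Proof. by case: a b => [? ?] []. Qed.

Lemma csmoothD O f g : open O -> csmooth_on O f -> csmooth_on O g ->
  csmooth_on O (fun q => f q + g q).
Proof.
move=> oO [sf tf] [sg tg]; split.
- by apply: (smooth_ext oO _ (smoothD oO sf sg)) => q _; rewrite ReD.
- by apply: (smooth_ext oO _ (smoothD oO tf tg)) => q _; rewrite ImD.
Qed.

Lemma csmoothM O f g : open O -> csmooth_on O f -> csmooth_on O g ->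
  csmooth_on O (fun q => f q * g q).
Proof.
move=> oO [sf tf] [sg tg]; split.
- apply: (smooth_ext oO _ (smoothB oO (smoothM oO sf sg) (smoothM oO tf tg))) => q _.
  by rewrite ReM.
- apply: (smooth_ext oO _ (smoothD oO (smoothM oO sf tg) (smoothM oO tf sg))) => q _.
  by rewrite ImM.
Qed.

Lemma csmooth_sum (I : Type) (s : seq I) O (F : I -> V -> C) : open O ->
  (forall i, csmooth_on O (F i)) -> csmooth_on O (fun p => \sum_(i <- s) F i p).
Proof.
move=> oO sF; elim: s => [|i s IH].
  by apply: (csmooth_ext oO _ (csmooth_cst O 0)) => p _; rewrite big_nil.
by apply: (csmooth_ext oO _ (csmoothD oO (sF i) IH)) => p _; rewrite big_cons.
Qed.

Lemma cpd_cst k (c : C) p : cpd k (fun=> c) p = 0.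
Proof. by rewrite /cpd !pd_cst. Qed.

Lemma near_eq_cpd k f g p : (\forall q \near p, f q = g q) -> cpd k f p = cpd k g p.
Proof.
by move=> fg; rewrite /cpd; congr Complex; apply: near_eq_pd; apply: filterS fg => q ->.
Qed.

Lemma near_eq_dzbar j f g p : (\forall q \near p, f q = g q) -> dzbar j f p = dzbar j g p.
Proof. by move=> fg; rewrite /dzbar !(near_eq_cpd _ fg). Qed.

Lemma cpdD O k f g p : csmooth_on O f -> csmooth_on O g -> O p ->
  cpd k (fun q => f q + g q) p = cpd k f p + cpd k g p.
Proof.
move=> [sf tf] [sg tg] Op; rewrite /cpd.
rewrite (_ : (fun q => complex.Re (f q + g q)) =
  fun q => complex.Re (f q) + complex.Re (g q)); last by apply/funext => q; rewrite ReD.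
rewrite (_ : (fun q => complex.Im (f q + g q)) =
  fun q => complex.Im (f q) + complex.Im (g q)); last by apply/funext => q; rewrite ImD.
by rewrite (pdD (smooth_drv sf Op) (smooth_drv sg Op)) (pdD (smooth_drv tf Op) (smooth_drv tg Op)).
Qed.

Lemma cpdM O k f g p : open O -> csmooth_on O f -> csmooth_on O g -> O p ->
  cpd k (fun q => f q * g q) p = cpd k f p * g p + f p * cpd k g p.
Proof.
move=> oO [sf tf] [sg tg] Op; rewrite /cpd.
rewrite (_ : (fun q => complex.Re (f q * g q)) =
  fun q => complex.Re (f q) * complex.Re (g q) - complex.Im (f q) * complex.Im (g q));
  last by apply/funext => q; rewrite ReM.
rewrite (_ : (fun q => complex.Im (f q * g q)) =
  fun q => complex.Re (f q) * complex.Im (g q) + complex.Im (f q) * complex.Re (g q));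
  last by apply/funext => q; rewrite ImM.
rewrite (pdB (smooth_drv (smoothM oO sf sg) Op) (smooth_drv (smoothM oO tf tg) Op)).
rewrite (pdD (smooth_drv (smoothM oO sf tg) Op) (smooth_drv (smoothM oO tf sg) Op)).
rewrite (pdM (smooth_drv sf Op) (smooth_drv sg Op)) (pdM (smooth_drv tf Op) (smooth_drv tg Op)).
rewrite (pdM (smooth_drv sf Op) (smooth_drv tg Op)) (pdM (smooth_drv tf Op) (smooth_drv sg Op)).
move=> /=; case: (f p) => a b; case: (g p) => c d /=.
move: (pd _ _ p) (pd _ _ p) (pd _ _ p) (pd _ _ p) => x y z t.
by apply/eqP; rewrite eq_complex /=; apply/andP; split; apply/eqP; ring.
Qed.

Lemma dzbarD O j f g p : csmooth_on O f -> csmooth_on O g -> O p ->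
  dzbar j (fun q => f q + g q) p = dzbar j f p + dzbar j g p.
Proof.
move=> sf sg Op; rewrite /dzbar !(cpdD _ sf sg Op).
by rewrite mulrDr addrACA mulrDl.
Qed.

Lemma dzbarM O j f g p : open O -> csmooth_on O f -> csmooth_on O g -> O p ->
  dzbar j (fun q => f q * g q) p = dzbar j f p * g p + f p * dzbar j g p.
Proof.
move=> oO sf sg Op; rewrite /dzbar !(cpdM _ oO sf sg Op).
move: (f p) (g p) (cpd (j, false) f p) (cpd (j, true) f p) (cpd (j, false) g p)
  (cpd (j, true) g p) ('i%C) (2^-1) => a b x y z t i h.
ring.
Qed.

Lemma dzbar_cst j (c : C) p : dzbar j (fun=> c) p = 0.
Proof. by rewrite /dzbar !cpd_cst mulr0 addr0 mul0r. Qed.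

Lemma dzbar_sum (I : Type) (s : seq I) O (F : I -> V -> C) j p : open O -> O p ->
  (forall i, csmooth_on O (F i)) ->
  dzbar j (fun p => \sum_(i <- s) F i p) p = \sum_(i <- s) dzbar j (F i) p.
Proof.
move=> oO Op sF; elim: s => [|i s IH].
  rewrite big_nil -[RHS](dzbar_cst j 0 p); congr (dzbar j _ p); apply/funext => q.
  by rewrite big_nil.
rewrite big_cons -IH -(dzbarD _ (sF i) (csmooth_sum _ oO sF) Op).
by congr (dzbar j _ p); apply/funext => q; rewrite big_cons.
Qed.

Lemma cauchy_riemann j f p : dzbar j f p = 0 <->
  pd (j, false) (fun q => complex.Re (f q)) p = pd (j, true) (fun q => complex.Im (f q)) p /\
  pd (j, true) (fun q => complex.Re (f q)) p = - pd (j, false) (fun q => complex.Im (f q)) p.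
Proof.
rewrite /dzbar /cpd.
move: (pd _ _ p) (pd _ _ p) (pd _ _ p) (pd _ _ p) => d c b a.
have -> : (Complex a b + 'i%C * Complex c d) = Complex (a - d) (b + c).
  by apply/eqP; rewrite eq_complex /=; apply/andP; split; apply/eqP; ring.
split=> [/eqP|[-> ->]]; last by rewrite subrr subrr mul0r.
rewrite mulf_eq0 invr_eq0 pnatr_eq0 orbF => /eqP[/eqP + /eqP].
by rewrite subr_eq0 addr_eq0 => /eqP -> /eqP ->; rewrite opprK.
Qed.

(** In each complex variable separately, the Cauchy-Riemann equations and the symmetry of mixed
    derivatives make the planar Laplacian vanish; [lap] is the sum of the two planar ones. *)
Lemma holomorphic_harmonic O f : open O -> holomorphic_on O f ->
  harmonic_on O (fun q => complex.Re (f q)) /\ harmonic_on O (fun q => complex.Im (f q)).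
Proof.
move=> oO [[sf tf] hf].
have cr j p : O p -> _ := fun Op => (cauchy_riemann j f p).1 (hf p Op j).
move: sf tf cr; set U := fun q => complex.Re (f q); set W := fun q => complex.Im (f q).
move=> sU sW cr.
have UU j p : O p -> pd (j, false) (pd (j, false) U) p + pd (j, true) (pd (j, true) U) p = 0.
  move=> Op.
  have -> : pd (j, false) (pd (j, false) U) p = pd (j, false) (pd (j, true) W) p.
    by apply: near_eq_pd; apply: filterS (near_open oO Op) => q /(cr j)[].
  have -> : pd (j, true) (pd (j, true) U) p = pd (j, true) (fun q => - pd (j, false) W q) p.
    by apply: near_eq_pd; apply: filterS (near_open oO Op) => q /(cr j)[].
  rewrite (pdN (smooth_drv (smooth_pd (j, false) sW) Op)).
  by rewrite (pd_commute (j, false) (j, true) oO sW Op) subrr.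
have WW j p : O p -> pd (j, false) (pd (j, false) W) p + pd (j, true) (pd (j, true) W) p = 0.
  move=> Op.
  have -> : pd (j, true) (pd (j, true) W) p = pd (j, true) (pd (j, false) U) p.
    by apply: near_eq_pd; apply: filterS (near_open oO Op) => q /(cr j)[].
  have -> : pd (j, false) (pd (j, false) W) p = pd (j, false) (fun q => - pd (j, true) U q) p.
    by apply: near_eq_pd; apply: filterS (near_open oO Op) => q /(cr j)[_ ->]; rewrite opprK.
  rewrite (pdN (smooth_drv (smooth_pd (j, true) sU) Op)).
  by rewrite (pd_commute (j, true) (j, false) oO sU Op) addNr.
split; split=> // p Op; rewrite /lap sum_dir.
- by rewrite (UU 0 p Op) add0r; exact: UU.
- by rewrite (WW 0 p Op) add0r; exact: WW.
Qed.

Lemma holomorphicW O O' f : O' `<=` O -> holomorphic_on O f -> holomorphic_on O' f.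
Proof. by move=> OO [sf hf]; split; [exact: csmoothW sf|move=> p /OO; exact: hf]. Qed.

(** First derivatives of the real and imaginary parts converge to those of f, so the Cauchy-Riemann
    equations pass to the limit. *)
Lemma holomorphic_limit G (hs : nat -> V -> C) f : open G ->
  (forall n, holomorphic_on G (hs n)) ->
  lucauchy G (fun n q => complex.Re (hs n q)) ->
  lucauchy G (fun n q => complex.Im (hs n q)) ->
  (forall p, G p -> complex.Re (hs n p) @[n --> \oo] --> complex.Re (f p)) ->
  (forall p, G p -> complex.Im (hs n p) @[n --> \oo] --> complex.Im (f p)) ->
  holomorphic_on G f.
Proof.
move=> oG hh lR lI cR cI.
have hR n := (holomorphic_harmonic oG (hh n)).1.
have hI n := (holomorphic_harmonic oG (hh n)).2.
have [sR dR] := harmonic_limit oG hR lR cR.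
have [sI dI] := harmonic_limit oG hI lI cI.
split=> // p Gp j; apply/cauchy_riemann; split.
- have := dR (j, false) p Gp.
  rewrite (_ : (fun n => _) = fun n => pd (j, true) (fun q => complex.Im (hs n q)) p).
    by move=> h; apply: (cvg_unique _ h (dI (j, true) p Gp)).
  by apply/funext => n; have [] := (cauchy_riemann j (hs n) p).1 ((hh n).2 p Gp j).
- have := dR (j, true) p Gp.
  rewrite (_ : (fun n => _) = fun n => - pd (j, false) (fun q => complex.Im (hs n q)) p).
    by move=> h; apply: (cvg_unique _ h (cvgN (dI (j, false) p Gp))).
  by apply/funext => n; have [] := (cauchy_riemann j (hs n) p).1 ((hh n).2 p Gp j).
Qed.

(** Complex-linear maps compose, written in real coordinates: [A] and [B] are the differentials of
    the real and imaginary parts of the outer function, [X] and [Y] the derivatives of the inner map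
    along x_j and y_j. *)
Lemma cauchy_riemann_chain (A B X Y : dir -> R) :
  (forall m, A (m, false) = B (m, true)) -> (forall m, A (m, true) = - B (m, false)) ->
  (forall m, X (m, false) = Y (m, true)) -> (forall m, Y (m, false) = - X (m, true)) ->
  \sum_(l : dir) A l * X l = \sum_(l : dir) B l * Y l /\
  \sum_(l : dir) A l * Y l = - \sum_(l : dir) B l * X l.
Proof.
by move=> a1 a2 x1 x2; rewrite !sum_dir !a1 !a2 !x1 !x2; split; ring.
Qed.

Lemma holomorphic_comp O O' f (T : V -> V) : open O -> open O' -> holomorphic_on O f ->
  (forall p, O' p -> O (T p)) -> (forall j, holomorphic_on O' (fun x => zcoord j (T x))) ->
  holomorphic_on O' (fun x => f (T x)).
Proof.
move=> oO oO' [[sU sW] hf] OT hT.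
have sT (l : dir) : smooth_on O' (fun x => rcoord l (T x)).
  by case: l => j []; have [[s1 s2] _] := hT j; [exact: s2|exact: s1].
have cU := smooth_comp oO oO' sU OT sT; have cW := smooth_comp oO oO' sW OT sT.
split=> // p Op j; apply/cauchy_riemann.
have dT k l : derivable (fun x => rcoord l (T x)) p (dirv k) := smooth_drv (sT l) Op.
have kT l : {for p, continuous (fun x => rcoord l (T x))} := smooth_cont (sT l) Op.
have EU k : pd k (fun x => complex.Re (f (T x))) p =
    \sum_(l : dir) pd l (fun q => complex.Re (f q)) (T p) * pd k (fun x => rcoord l (T x)) p.
  by have [_] := pd_comp oO sU (OT p Op) kT (dT k).
have EW k : pd k (fun x => complex.Im (f (T x))) p =
    \sum_(l : dir) pd l (fun q => complex.Im (f q)) (T p) * pd k (fun x => rcoord l (T x)) p.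
  by have [_] := pd_comp oO sW (OT p Op) kT (dT k).
have cf m := (cauchy_riemann m f (T p)).1 (hf (T p) (OT p Op) m).
have ct m := (cauchy_riemann j _ p).1 ((hT m).2 p Op j).
have [cr1 cr2] := @cauchy_riemann_chain (fun l => pd l (fun q => complex.Re (f q)) (T p))
  (fun l => pd l (fun q => complex.Im (f q)) (T p))
  (fun l => pd (j, false) (fun x => rcoord l (T x)) p)
  (fun l => pd (j, true) (fun x => rcoord l (T x)) p)
  (fun m => (cf m).1) (fun m => (cf m).2) (fun m => (ct m).1) (fun m => (ct m).2).
split.
- apply: etrans (EU (j, false)) _; apply: etrans cr1 _; exact/esym/EW.
- apply: etrans (EU (j, true)) _; apply: etrans cr2 _; congr (- _); exact/esym/EW.
Qed.

End Holomorphic.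

(** * Norms of endomorphism-valued forms *)

Section Modulus.
Context {R : realType}.
Local Notation C := R[i].

(** The modulus with values in R, whereas the norm of [R[i]] takes its values in [R[i]]. *)
Definition cmod (z : C) : R := Normc.normc z.

Lemma cmodM (a b : C) : cmod (a * b) = cmod a * cmod b.
Proof. exact: Normc.normcM. Qed.

Lemma cmodD (a b : C) : cmod (a + b) <= cmod a + cmod b.
Proof. exact: le_normcD. Qed.

Lemma cmodN (a : C) : cmod (- a) = cmod a.
Proof. exact: normcN. Qed.

Lemma cmodJ (a : C) : cmod (conjc a) = cmod a.
Proof. by case: a => a b; rewrite /cmod /= sqrrN. Qed.

Lemma cmod0 : cmod 0 = 0.
Proof. exact: Normc.normc0. Qed.

Lemma cmod_ge0 (a : C) : 0 <= cmod a.
Proof. by case: a => a b; rewrite /cmod /= sqrtr_ge0. Qed.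

Lemma cmodB (a b : C) : cmod (a - b) = cmod (b - a).
Proof. by rewrite -cmodN opprB. Qed.

Lemma Re_le_cmod (a : C) : `|complex.Re a| <= cmod a.
Proof.
case: a => a b; rewrite /cmod /= -sqrtr_sqr ler_wsqrtr // lerDl; exact: sqr_ge0.
Qed.

Lemma Im_le_cmod (a : C) : `|complex.Im a| <= cmod a.
Proof.
case: a => a b; rewrite /cmod /= -sqrtr_sqr ler_wsqrtr // lerDr; exact: sqr_ge0.
Qed.

Lemma cmod_sum (I : Type) (s : seq I) (F : I -> C) :
  cmod (\sum_(i <- s) F i) <= \sum_(i <- s) cmod (F i).
Proof.
elim: s => [|i s IH]; first by rewrite !big_nil cmod0.
by rewrite !big_cons (le_trans (cmodD _ _)) // lerD2l.
Qed.

Lemma cmod_sqr (a : C) : (cmod a ^+ 2)%:C%C = a * conjc a.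
Proof.
case: a => a b; rewrite /cmod /= sqr_sqrtr ?addr_ge0 ?sqr_ge0 //.
by apply/eqP; rewrite eq_complex /=; apply/andP; split; apply/eqP; ring.
Qed.

Lemma Re_conjM (a : C) : complex.Re (a * conjc a) = cmod a ^+ 2.
Proof. by rewrite -cmod_sqr. Qed.

Lemma Re_sum (I : Type) (s : seq I) (F : I -> C) :
  complex.Re (\sum_(i <- s) F i) = \sum_(i <- s) complex.Re (F i).
Proof. exact: (big_morph _ (@raddfD _ _ (@complex.Re R)) erefl). Qed.

Lemma positive_sqrt (a : C) : 0 < a -> exists s : C, [/\ s != 0, conjc s = s & s * s = a].
Proof.
case: a => a b; rewrite ltcE /= => /andP[/eqP b0 a0]; rewrite {b}b0.
exists (Num.sqrt a)%:C%C; split.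
- by rewrite eq_complex /= negb_and gt_eqF // sqrtr_gt0.
- by rewrite /= oppr0.
- rewrite -rmorphM /= -expr2 sqr_sqrtr ?ltW //.
Qed.

End Modulus.

(** * Adjoints and positive Hermitian matrices *)

Section Hermitian.
Context {R : realType}.
Local Notation C := R[i].

Lemma adjM m n p (A : 'M[C]_(m, n)) (B : 'M[C]_(n, p)) : adj (A *m B) = adj B *m adj A.
Proof. by rewrite /adj trmx_mul map_mxM. Qed.

Lemma adjE m n (A : 'M[C]_(m, n)) i j : adj A i j = conjc (A j i).
Proof. by rewrite /adj !mxE. Qed.

Lemma adj_inv n (A : 'M[C]_n) : adj (invmx A) = invmx (adj A).
Proof. by rewrite /adj trmx_inv map_invmx. Qed.

Lemma adj_unit n (A : 'M[C]_n) : (adj A \in unitmx) = (A \in unitmx).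
Proof. by rewrite /adj map_unitmx unitmx_tr. Qed.

Lemma adjZ m n (c : C) (A : 'M[C]_(m, n)) : adj (c *: A) = conjc c *: adj A.
Proof. by apply/matrixP => i j; rewrite [RHS]mxE !adjE mxE rmorphM. Qed.

Lemma adj_sum m n (I : Type) (s : seq I) (F : I -> 'M[C]_(m, n)) :
  adj (\sum_(i <- s) F i) = \sum_(i <- s) adj (F i).
Proof.
apply/matrixP => i j; rewrite adjE !summxE rmorph_sum; apply: eq_bigr => k _.
by rewrite adjE.
Qed.

Lemma invmxM n (A B : 'M[C]_n) : A \in unitmx -> B \in unitmx ->
  invmx (A *m B) = invmx B *m invmx A.
Proof.
move=> uA uB; have uAB : A *m B \in unitmx by rewrite unitmx_mul uA.
rewrite -[RHS]mul1mx -(mulVmx uAB) -[LHS]mulmx1 -!mulmxA; congr (_ *m _).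
by rewrite (mulmxA B) mulmxV // mul1mx mulmxV // mulmx1.
Qed.

(** Cholesky factorisation: P is upper triangular with rows (s, b / s) and (0, t), where s^2 = a and
    t^2 is the Schur complement d - |b|^2 / a. *)
Lemma positive_hermitian_factor (M : 'M[C]_2) : positive_hermitian M ->
  exists2 P, P \in unitmx & M = adj P *m P.
Proof.
move=> [hM pM].
have quad (v : 'cV[C]_2) : (adj v *m M *m v) 0 0 =
    (conjc (v 0 0) * M 0 0 + conjc (v 1 0) * M 1 0) * v 0 0 +
    (conjc (v 0 0) * M 0 1 + conjc (v 1 0) * M 1 1) * v 1 0.
  rewrite !mxE !big_ord_recl big_ord0 !mxE !big_ord_recl !big_ord0 !adjE !addr0.
  by rewrite (_ : lift _ _ = 1) //; apply/val_inj.
pose a := M 0 0; pose b := M 0 1; pose d := M 1 1.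
have M10 : M 1 0 = conjc b by rewrite -hM adjE.
have ra : conjc a = a by rewrite /a -[in RHS]hM adjE.
have a0 : 0 < a.
  have := pM (\col_i (i == 0)%:R); rewrite quad !mxE !conjc_nat /=.
  rewrite !mul1r !mul0r !addr0 mulr0 mulr1 addr0; apply.
  apply/eqP => /matrixP /(_ 0 0); rewrite !mxE eqxx => /eqP; by rewrite oner_eq0.
have na : a != 0 by rewrite gt_eqF.
have d0 : 0 < d - b * conjc b / a.
  (* On the vector (-b, a) the Hermitian form takes the value a^2 times the Schur complement. *)
  have := pM (\col_i (if i == 0 then - b else a)); rewrite quad !mxE /= -/a -/b -/d M10 ra.
  rewrite (_ : _ + _ = a * (a * (d - b * conjc b / a))); last first.
    rewrite rmorphN /=; field; exact: na.
  move=> H; have : 0 < a * (a * (d - b * conjc b / a)).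
    apply: H; apply/eqP => /matrixP /(_ 1 0); rewrite !mxE /= => /eqP.
    by rewrite (negbTE na).
  by rewrite !pmulr_rgt0.
have [s [s0 rs ss]] := positive_sqrt a0.
have [t [t0 rt tt]] := positive_sqrt d0.
pose P : 'M[C]_2 := \matrix_(i, j) (if i == 0 then (if j == 0 then s else b / s)
   else if j == 0 then 0 else t).
exists P.
  rewrite unitmxE -det_tr (@det_trig _ _ P^T); last first.
    by apply/is_trig_mxP => -[[|[|i]] // hi] -[[|[|j]] // hj] //= _; rewrite !mxE.
  by rewrite !big_ord_recl big_ord0 !mxE /= mulr1 unitfE mulf_neq0.
have E (i j : 'I_2) : (adj P *m P) i j = conjc (P 0 i) * P 0 j + conjc (P 1 i) * P 1 j.
  rewrite mxE !big_ord_recl big_ord0 !adjE addr0.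
  by rewrite (_ : lift _ _ = 1) //; apply/val_inj.
have two (i : 'I_2) : i = 0 \/ i = 1.
  by case: i => -[|[|i]] // hi; [left|right]; apply/val_inj.
apply/matrixP => i j; rewrite E !mxE.
case: (two i) => ->; case: (two j) => -> /=; rewrite ?conjc0 ?rs ?rt ?mul0r ?mulr0 ?addr0.
- by rewrite ss.
- have -> : Complex 0 (- 0) = 0 :> C by rewrite oppr0.
  by rewrite mul0r addr0 mulrCA mulfV // mulr1.
- by rewrite rmorphM /= conjc_inv rs mulfVK // M10.
- rewrite tt rmorphM /= conjc_inv rs -ss -/d; field; exact: s0.
Qed.

End Hermitian.

(** * The pointwise norm as a function of matrices *)

Section FormNorm.
Context {R : realType}.
Local Notation C := R[i].
Implicit Types (M h : 'M[C]_2).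

Definition gram r (h : 'M[C]_r) (psi : 'I_2 -> 'M[C]_r) : 'M[C]_2 :=
  \matrix_(j, k) \tr (psi j *m star h (psi k)).

(** The body of [pnorm] with the Kaehler matrix and the bundle metric at one point as plain
    arguments, so that changes of chart and frame become matrix identities. *)
Definition form_norm r (M : 'M[C]_2) (h : 'M[C]_r) (psi : 'I_2 -> 'M[C]_r) : R :=
  Num.sqrt (complex.Re (2 * \sum_j \sum_k invmx M k j * \tr (psi j *m star h (psi k)))).

Lemma form_normE r M (h : 'M[C]_r) psi :
  form_norm M h psi = Num.sqrt (complex.Re (2 * \tr (invmx M *m gram h psi))).
Proof.
rewrite /form_norm; congr (Num.sqrt (complex.Re (2 * _))).
rewrite exchange_big /=; apply: eq_bigr => k _; rewrite mxE; apply: eq_bigr => j _.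
by rewrite mxE.
Qed.

Lemma star_conj r (g h A : 'M[C]_r) : g \in unitmx -> h \in unitmx ->
  star (adj g *m h *m g) (invmx g *m A *m g) = invmx g *m star h A *m g.
Proof.
move=> ug uh; have uag : adj g \in unitmx by rewrite adj_unit.
rewrite /star (invmxM (A := adj g *m h)) ?unitmx_mul ?uag // (invmxM uag uh).
rewrite !adjM adj_inv.
have := mulVmx uag.
move: (adj g) (adj A) (invmx h) (invmx g) => ag aA ih ig H.
by rewrite -!mulmxA !(mulmxA (invmx ag) ag) H !mul1mx.
Qed.

Lemma conjmxM r (g X Y : 'M[C]_r) : g \in unitmx ->
  (invmx g *m X *m g) *m (invmx g *m Y *m g) = invmx g *m (X *m Y) *m g.
Proof.
move=> /mulmxV; move: (invmx g) => ig H.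
by rewrite -!mulmxA (mulmxA g ig) H mul1mx.
Qed.

Lemma mxtrace_conj r (g X : 'M[C]_r) : g \in unitmx -> \tr (invmx g *m X *m g) = \tr X.
Proof. by move=> ug; rewrite mxtrace_mulC mulmxA mulmxV // mul1mx. Qed.

Lemma gram_conj r (g h : 'M[C]_r) psi : g \in unitmx -> h \in unitmx ->
  gram (adj g *m h *m g) (fun j => invmx g *m psi j *m g) = gram h psi.
Proof.
move=> ug uh; apply/matrixP => j k; rewrite !mxE star_conj //.
by rewrite conjmxM // mxtrace_conj.
Qed.

Lemma form_norm_conj r M (g h : 'M[C]_r) psi : g \in unitmx -> h \in unitmx ->
  form_norm M (adj g *m h *m g) (fun j => invmx g *m psi j *m g) = form_norm M h psi.
Proof. by move=> ug uh; rewrite !form_normE gram_conj. Qed.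

Lemma eq_form_norm r M (h : 'M[C]_r) psi psi' : psi =1 psi' ->
  form_norm M h psi = form_norm M h psi'.
Proof. by move=> e; congr (form_norm _ _ _); exact/funext. Qed.

Lemma star_sum r (h : 'M[C]_r) (c : 'I_2 -> C) (F : 'I_2 -> 'M[C]_r) :
  star h (\sum_m c m *: F m) = \sum_m conjc (c m) *: star h (F m).
Proof.
rewrite /star adj_sum mulmx_sumr mulmx_suml; apply: eq_bigr => m _.
by rewrite adjZ -scalemxAr -scalemxAl.
Qed.

Lemma gram_chart r (h : 'M[C]_r) (J : 'M[C]_2) psi :
  gram h (fun j => \sum_m J m j *: psi m) = J^T *m gram h psi *m map_mx conjc J.
Proof.
apply/matrixP => j k; rewrite [LHS]mxE [RHS]mxE star_sum mulmx_sumr raddf_sum /=.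
apply: eq_bigr => n _; rewrite -scalemxAr mxtraceZ mulmx_suml raddf_sum /=.
rewrite [map_mx _ _ _ _]mxE [(_ *m _) j n]mxE mulrC; congr (_ * _).
by apply: eq_bigr => m _; rewrite -scalemxAl mxtraceZ [J^T _ _]mxE [gram _ _ _ _]mxE.
Qed.

(** [M] and the Gram matrix transform by the same congruence; since [M] enters through its inverse,
    the Jacobians cancel cyclically under the trace. *)
Lemma form_norm_chart r M (h : 'M[C]_r) (J : 'M[C]_2) psi : M \in unitmx -> J \in unitmx ->
  form_norm (J^T *m M *m map_mx conjc J) h (fun j => \sum_m J m j *: psi m) =
  form_norm M h psi.
Proof.
move=> uM uJ; rewrite !form_normE gram_chart.
have uT : J^T \in unitmx by rewrite unitmx_tr.
have uc : map_mx conjc J \in unitmx by rewrite map_unitmx.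
have uTM : J^T *m M \in unitmx by rewrite unitmx_mul uT.
rewrite (invmxM uTM uc) (invmxM uT uM); have := mulVmx uT; have := mulmxV uc.
move: (map_mx conjc J) J^T (gram h psi) (invmx M) => b a G iM Hb Ha.
rewrite -!mulmxA (mulmxA (invmx a) a) Ha mul1mx mxtrace_mulC.
by rewrite -!mulmxA Hb mulmx1.
Qed.

(** The square of the Frobenius norm. *)
Definition frob r (A : 'M[C]_r) : R := complex.Re (\tr (A *m adj A)).

Lemma frobE r (A : 'M[C]_r) : frob A = \sum_i \sum_j cmod (A i j) ^+ 2.
Proof.
rewrite /frob /mxtrace Re_sum; apply: eq_bigr => i _.
by rewrite mxE Re_sum; apply: eq_bigr => j _; rewrite adjE Re_conjM.
Qed.

Lemma trace_frob r (A : 'M[C]_r) : \tr (A *m adj A) = (frob A)%:C%C.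
Proof.
rewrite frobE rmorph_sum; apply: eq_bigr => i _.
by rewrite mxE rmorph_sum; apply: eq_bigr => j _; rewrite adjE -cmod_sqr.
Qed.

Lemma frob_ge0 r (A : 'M[C]_r) : 0 <= frob A.
Proof. by rewrite frobE; do 2 (apply: sumr_ge0 => ? _); exact: sqr_ge0. Qed.

Lemma frob_entry r (A : 'M[C]_r) i j : cmod (A i j) ^+ 2 <= frob A.
Proof.
rewrite frobE (bigD1 i) //= (bigD1 j) //= -addrA lerDl addr_ge0 //.
  by apply: sumr_ge0 => ? _; exact: sqr_ge0.
by do 2 (apply: sumr_ge0 => ? _); exact: sqr_ge0.
Qed.

Lemma adj_factor_entry n (Q : 'M[C]_n) m j :
  cmod (Q m j) ^+ 2 <= complex.Re (\tr (adj Q *m Q)).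
Proof. by rewrite mxtrace_mulC; exact: frob_entry. Qed.

Lemma gram_factor r (P : 'M[C]_r) psi : P \in unitmx ->
  gram (adj P *m P) psi = gram 1%:M (fun j => P *m psi j *m invmx P).
Proof.
move=> uP; have e := gram_conj (fun j => P *m psi j *m invmx P) uP (unitmx1 _ _).
rewrite mulmx1 in e; rewrite -e; congr (gram _ _); apply/funext => j.
have := mulVmx uP; move: (invmx P) => iP H.
by rewrite !mulmxA H mul1mx -mulmxA H mulmx1.
Qed.

Lemma trace_factor n (Q G : 'M[C]_n) : Q \in unitmx ->
  \tr (invmx (adj Q *m Q) *m G) = \tr (adj (invmx Q) *m G *m invmx Q).
Proof.
move=> uQ; have uaQ : adj Q \in unitmx by rewrite adj_unit.
by rewrite (invmxM uaQ uQ) -adj_inv -mulmxA mxtrace_mulC.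
Qed.

(* Writing [M = Q^* Q] and [h = P^* P], the form norm is the Frobenius norm of
   the forms [P psi_j P^-1] expressed in an orthonormal coframe. *)
Lemma form_norm_frob r (P : 'M[C]_r) (Q : 'M[C]_2) psi : P \in unitmx -> Q \in unitmx ->
  let S := invmx Q in
  let chi m := \sum_j conjc (S j m) *: (P *m psi j *m invmx P) in
  form_norm (adj Q *m Q) (adj P *m P) psi = Num.sqrt (2 * \sum_m frob (chi m)).
Proof.
move=> uP uQ S chi; rewrite form_normE (gram_factor _ uP) (trace_factor _ uQ); congr Num.sqrt.
have -> : \tr (adj (invmx Q) *m gram 1%:M (fun j => P *m psi j *m invmx P) *m invmx Q) =
          \tr (gram 1%:M chi).
  congr (\tr _); have := gram_chart 1%:M (map_mx conjc S) (fun j => P *m psi j *m invmx P).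
  have -> : map_mx conjc (map_mx conjc S) = S.
    by apply/matrixP => i j; rewrite mxE [map_mx _ _ _ _]mxE conjcK.
  rewrite map_trmx -/(adj S) => <-; congr (gram _ _); apply/funext => m.
  by apply: eq_bigr => j _; rewrite mxE.
rewrite (_ : \tr _ = (\sum_m frob (chi m))%:C%C).
  by rewrite -(rmorph_nat (real_complex R)) -rmorphM.
rewrite /mxtrace rmorph_sum; apply: eq_bigr => m _.
by rewrite mxE /star invmx1 mul1mx mulmx1 trace_frob.
Qed.

(** In a unitary frame psi_j is the sum over m of conj(Q_mj) chi_m, where |Q_mj|^2 <= tr M and the
    entries of chi_m are at most the form norm; the factor 2 counts the terms. *)
Lemma form_entry_bound (M P : 'M[C]_2) psi j p q : positive_hermitian M -> P \in unitmx ->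
  cmod ((P *m psi j *m invmx P) p q) <=
    2 * (Num.sqrt (complex.Re (\tr M)) * form_norm M (adj P *m P) psi).
Proof.
move=> /positive_hermitian_factor[Q uQ ->] uP.
pose S := invmx Q.
pose chi m := \sum_j conjc (S j m) *: (P *m psi j *m invmx P).
have -> : form_norm (adj Q *m Q) (adj P *m P) psi = Num.sqrt (2 * \sum_m frob (chi m)) :=
  form_norm_frob psi uP uQ.
set k := Num.sqrt (complex.Re _); set N := Num.sqrt _.
have sum0 : 0 <= \sum_m frob (chi m) by apply: sumr_ge0 => m _; exact: frob_ge0.
have E : P *m psi j *m invmx P = \sum_m conjc (Q m j) *: chi m.
  rewrite /chi; under eq_bigr => m _ do rewrite scaler_sumr.
  rewrite exchange_big /=.
  under eq_bigr => i _.
    under eq_bigr => m _ do rewrite scalerA -rmorphM.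
    rewrite -scaler_suml -rmorph_sum.
    over.
  have SQ i : \sum_m Q m j * S i m = (i == j)%:R.
    have := mulVmx uQ => /matrixP /(_ i j); rewrite !mxE => <-.
    by apply: eq_bigr => m _; rewrite mulrC.
  rewrite (bigD1 j) //= SQ eqxx conjc1 scale1r big1 ?addr0 // => i ij.
  by rewrite SQ (negbTE ij) conjc0 scale0r.
have chiN m : cmod (chi m p q) <= N.
  rewrite -[leLHS]ger0_norm ?cmod_ge0 // -sqrtr_sqr ler_wsqrtr //.
  apply: le_trans (frob_entry _ _ _) _.
  apply: (@le_trans _ _ (\sum_m frob (chi m))).
    by rewrite (bigD1 m) //= lerDl; apply: sumr_ge0 => ? _; exact: frob_ge0.
  by rewrite ler_peMl // ler1n.
have Qk m : cmod (Q m j) <= k.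
  rewrite -[leLHS]ger0_norm ?cmod_ge0 // -sqrtr_sqr ler_wsqrtr //.
  exact: adj_factor_entry.
rewrite E summxE; apply: le_trans (cmod_sum _ _) _.
have step m : cmod ((conjc (Q m j) *: chi m) p q) <= k * N.
  by rewrite mxE cmodM cmodJ ler_pM ?cmod_ge0.
apply: le_trans (ler_sum _ (fun m _ => step m)) _.
by rewrite sumr_const card_ord mulr_natl.
Qed.

(** The trace may be computed in a unitary frame, where it is a sum of four products of two entries,
    each product at most 2 * 2 times tr M and the two norms: hence 16. Having two forms [a] and [b]
    serves to estimate differences of squares. *)
Lemma trace_le_form_norm (M h : 'M[C]_2) a b j k : positive_hermitian M ->
  positive_hermitian h ->
  cmod (\tr (a j *m b k)) <=
    16 * complex.Re (\tr M) * (form_norm M h a * form_norm M h b).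
Proof.
move=> hM /positive_hermitian_factor[P uP ->].
have -> : \tr (a j *m b k) = \tr ((P *m a j *m invmx P) *m (P *m b k *m invmx P)).
  rewrite -!mulmxA (mulmxA (invmx P)) mulVmx // mul1mx [RHS]mxtrace_mulC.
  by rewrite -!mulmxA mulVmx // mulmx1.
set A := P *m _ *m _; set B := P *m _ *m _.
have tM0 : 0 <= complex.Re (\tr M).
  have [Q _ ->] := positive_hermitian_factor hM; rewrite mxtrace_mulC; exact: frob_ge0.
have bound p q : cmod (A p q * B q p) <=
    4 * (complex.Re (\tr M) * (form_norm M (adj P *m P) a * form_norm M (adj P *m P) b)).
  rewrite cmodM.
  have := ler_pM (cmod_ge0 _) (cmod_ge0 _) (form_entry_bound a j p q hM uP)
    (form_entry_bound b k q p hM uP).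
  rewrite -/A -/B -[X in _ -> _ <= 4 * (X * _)](sqr_sqrtr tM0).
  move: (Num.sqrt _) (form_norm _ _ a) (form_norm _ _ b) => s u v H; apply: le_trans H _.
  by rewrite le_eqVlt; apply/orP; left; apply/eqP; ring.
rewrite /mxtrace; apply: le_trans (cmod_sum _ _) _.
have row p : cmod ((A *m B) p p) <=
    8 * (complex.Re (\tr M) * (form_norm M (adj P *m P) a * form_norm M (adj P *m P) b)).
  rewrite mxE; apply: le_trans (cmod_sum _ _) _.
  apply: le_trans (ler_sum _ (fun q _ => bound p q)) _.
  rewrite sumr_const card_ord; move: (complex.Re _ * (_ * _)) => X.
  by rewrite (_ : (4 * X) *+ 2 = 8 * X) //; ring.
apply: le_trans (ler_sum _ (fun p _ => row p)) _.
rewrite sumr_const card_ord -(mulrA 16); move: (complex.Re _ * (_ * _)) => X.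
by rewrite (_ : (8 * X) *+ 2 = 16 * X) //; ring.
Qed.

End FormNorm.

Section MoreHolomorphic.
Context {R : realType}.
Local Notation V := (C2 R).
Local Notation C := R[i].
Implicit Types (O G : set V) (f g : V -> C) (p : V).

Lemma holomorphicM O f g : open O -> holomorphic_on O f -> holomorphic_on O g ->
  holomorphic_on O (fun q => f q * g q).
Proof.
move=> oO [sf hf] [sg hg]; split; first exact: csmoothM.
by move=> p Op j; rewrite (dzbarM _ oO sf sg Op) (hf p Op) (hg p Op) mul0r mulr0 addr0.
Qed.

Lemma holomorphic_cst O (c : C) : holomorphic_on O (fun=> c).
Proof. by split; [exact: csmooth_cst|move=> p _ j; exact: dzbar_cst]. Qed.

Lemma holomorphic_zcoord_sub O (i : 'I_2) (c : C) : open O ->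
  holomorphic_on O (fun p => zcoord i p - c).
Proof.
move=> oO; split.
  apply: csmoothD => //; last exact: csmooth_cst.
  by split; [exact: (@smooth_rcoord R O (i, false))|exact: (@smooth_rcoord R O (i, true))].
move=> p Op j; apply/cauchy_riemann.
rewrite (_ : (fun q => complex.Re (zcoord i q - c)) =
  fun q => rcoord (i, false) q - complex.Re c); last first.
  by apply/funext => q; rewrite /rcoord /=; case: (zcoord i q) => ? ?; case: c.
rewrite (_ : (fun q => complex.Im (zcoord i q - c)) =
  fun q => rcoord (i, true) q - complex.Im c); last first.
  by apply/funext => q; rewrite /rcoord /=; case: (zcoord i q) => ? ?; case: c.
have e k l (d : R) : pd k (fun q => rcoord l q - d) p = (k == l)%:R.
  have d1 : derivable (@rcoord R l) p (dirv k) by have [] := rcoord_derive k l p.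
  by rewrite (pdB d1 (derivable_cst _ _ _)) pd_cst subr0 pd_rcoord.
by rewrite !e !xpair_eqE /= !andbT !andbF oppr0.
Qed.

End MoreHolomorphic.

(** * The quadratic differential tr (phi (x) phi) *)

Section Geometry.
Context {R : realType} (X : complex_surface R).
Local Notation C := R[i].
Local Notation V := (C2 R).

Lemma near_param (al : chart X) (W : set X) x : open W -> cdom al x -> W x ->
  \forall p \near coord al x, (coord al @` cdom al) p /\ W (param al p).
Proof.
move=> oW ax Wx.
have c1 : nbhs (coord al x) (coord al @` cdom al).
  by apply: near_open; [exact: coord_open|exists x].
have c2 : \forall p \near coord al x, W (param al p).
  have pc : param al p @[p --> coord al x] --> param al (coord al x) := param_continuous ax.
  rewrite coordK // in pc; apply: (pc W); exact: open_nbhs_nbhs.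
exact: filterI c1 c2.
Qed.

Lemma cimg_open (al : chart X) (W : set X) : open W -> open (cimg al W).
Proof.
move=> oW; rewrite openE => _ [x [ax Wx] <-]; rewrite /interior.
apply: filterS (near_param oW ax Wx) => _ [[y ay <-]]; rewrite coordK // => Wy.
by exists y.
Qed.

Lemma cimg_param (al : chart X) (W : set X) p : cimg al W p ->
  [/\ cdom al (param al p), W (param al p) & coord al (param al p) = p].
Proof. by move=> [x [ax Wx] <-]; rewrite coordK. Qed.

Lemma positive_unit (M : 'M[C]_2) : positive_hermitian M -> M \in unitmx.
Proof.
by move=> /positive_hermitian_factor[P uP ->]; rewrite unitmx_mul adj_unit uP.
Qed.

Section Kahler.
Variable K : kahler_metric X.

Definition jac (al be : chart X) x : 'M[C]_2 := \matrix_(m, j) cjac al be m j x.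

Lemma kmx_jac al be x : cdom al x -> cdom be x ->
  kmx K be x = (jac al be x)^T *m kmx K al x *m map_mx conjc (jac al be x).
Proof.
move=> ax bx; apply/matrixP => j k; rewrite (kmx_chart K ax bx) mxE exchange_big /=.
apply: eq_bigr => n _; rewrite [(_ *m _) _ _]mxE mulr_suml; apply: eq_bigr => m _.
by rewrite !mxE mulrAC.
Qed.

(** Invertibility is read off the Kaehler metric: its matrix in the second chart is invertible and
    has the transposed Jacobian as a factor. *)
Lemma jac_unit al be x : cdom al x -> cdom be x -> jac al be x \in unitmx.
Proof.
move=> ax bx; have := positive_unit (kmx_positive K bx).
by rewrite (kmx_jac ax bx) !unitmx_mul => /andP[/andP[+ _] _]; rewrite unitmx_tr.
Qed.

Context (W : set X) (E : vector_bundle W 2) (h : hermitian_metric E).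

Lemma pnorm_chart al be a x (psi psi' : 'I_2 -> 'M[C]_2) : cdom al x -> cdom be x ->
  (forall j, psi' j = \sum_m cjac al be m j x *: psi m) ->
  pnorm K h be a x psi' = pnorm K h al a x psi.
Proof.
move=> ax bx e.
rewrite -[LHS]/(form_norm (kmx K be x) (h a x) psi').
rewrite -[RHS]/(form_norm (kmx K al x) (h a x) psi) (kmx_jac ax bx).
rewrite -(form_norm_chart (h a x) psi (positive_unit (kmx_positive K ax)) (jac_unit ax bx)).
by apply: eq_form_norm => j; rewrite e; apply: eq_bigr => m _; rewrite mxE.
Qed.

Lemma trans_unit a b x : fdom a x -> fdom b x -> trans (v := E) a b x \in unitmx.
Proof.
move=> ax bx; have := trans_cocycle ax bx ax; rewrite trans_id // => e.
by have [] := mulmx1_unit e.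
Qed.

Lemma pnorm_frame al a b x (psi : 'I_2 -> 'M[C]_2) : fdom a x -> fdom b x ->
  pnorm K h al b x (fun j => invmx (trans a b x) *m psi j *m trans a b x) =
  pnorm K h al a x psi.
Proof.
move=> ax bx.
rewrite -[LHS]/(form_norm (kmx K al x) (h b x) _).
rewrite -[RHS]/(form_norm (kmx K al x) (h a x) psi) (hmx_frame h ax bx).
exact: form_norm_conj (trans_unit ax bx) (positive_unit (hmx_positive h ax)).
Qed.

Lemma norm10E (psi : form10 E) al a x : is_form10 psi -> W x -> cdom al x -> fdom a x ->
  norm10 K h psi x = pnorm K h al a x (fun j => psi al a j x).
Proof.
move=> [f1 f2] Wx ax aa; rewrite /norm10.
have cx := chart_atP x; have fx := @frame_atP _ _ _ _ E x Wx.
have -> : pnorm K h al a x (fun j => psi al a j x) =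
    pnorm K h (chart_at x) a x (fun j => psi (chart_at x) a j x).
  by apply: (pnorm_chart _ cx ax) => j; exact: f1.
rewrite -(pnorm_frame _ _ aa fx); apply: (congr1 (pnorm K h _ _ _)); apply/funext => j.
exact: f2.
Qed.

End Kahler.

Section QuadraticDifferential.
Context (E : vector_bundle [set: X] 2).

(* The coefficient of [dz_j^2] in the quadratic differential [tr (psi (x) psi)]. *)
Definition qform (psi : form10 E) (al : chart X) (j : 'I_2) (x : X) : C :=
  \tr (psi al (frame_at E x) j x *m psi al (frame_at E x) j x).

Lemma qformE psi al a j x : is_form10 psi -> cdom al x -> fdom a x ->
  qform psi al j x = \tr (psi al a j x *m psi al a j x).
Proof.
move=> [_ f2] ax aa; have fx := @frame_atP _ _ _ _ E x I.
rewrite /qform (f2 al a (frame_at E x) j x ax aa fx).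
by rewrite conjmxM ?mxtrace_conj ?trans_unit.
Qed.

(** The reason why the connection disappears from dbar tr (phi_j phi_j): dbar_A phi = 0 makes the
    derivative of phi_j a commutator, and the trace is cyclic. *)
Lemma trace_commutator r (B M : 'M[C]_r) :
  \tr (- comm B M *m M) + \tr (M *m - comm B M) = 0.
Proof.
have t : \tr (comm B M *m M) = 0.
  rewrite /comm mulmxBl raddfB /= -[B *m M *m M]mulmxA (mxtrace_mulC B).
  by rewrite [\tr (M *m B *m M)]mxtrace_mulC mulmxA subrr.
by rewrite [\tr (M *m _)]mxtrace_mulC mulNmx raddfN /= t oppr0 addr0.
Qed.

Lemma qform_holomorphic (A : connection_form E) (psi : form10 E) al j :
  is_form10 psi -> smooth_form10 psi ->
  (forall a x, cdom al x -> fdom a x -> forall k,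
     mdzbarX al k (psi al a j) x + comm (conn01 A al a k x) (psi al a j x) = 0) ->
  holomorphic_on (cimg al setT) (fun p => qform psi al j (param al p)).
Proof.
move=> fpsi spsi dpsi.
(* [qform] uses the frame [frame_at E x], which may jump with x. Over the domain of one frame [a] it
   agrees with this sum of products of smooth entries. *)
pose loc a p : C := \sum_i \sum_k (psi al a j (param al p) i k * psi al a j (param al p) k i).
have oa (a : frame E) : open (cimg al (fdom a)) by apply: cimg_open; exact: fdom_open.
have qE a p : cimg al (fdom a) p -> loc a p = qform psi al j (param al p).
  move=> /cimg_param[c1 c2 _]; rewrite (qformE j fpsi c1 c2).
  by apply: eq_bigr => i _; rewrite mxE.
have s2 a i k : csmooth_on (cimg al (fdom a))
    (fun p => psi al a j (param al p) i k * psi al a j (param al p) k i).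
  by apply: csmoothM => //; exact: spsi.
have s1 a i : csmooth_on (cimg al (fdom a))
    (fun p => \sum_k psi al a j (param al p) i k * psi al a j (param al p) k i).
  exact: csmooth_sum.
have sl a : csmooth_on (cimg al (fdom a)) (loc a) by exact: csmooth_sum.
have sq (a : frame E) : csmooth_on (cimg al (fdom a)) (fun p => qform psi al j (param al p)).
  exact: (csmooth_ext (oa a) (qE a) (sl a)).
have cov p : cimg al setT p -> exists a : frame E, cimg al (fdom a) p.
  move=> [x [ax _] <-]; exists (frame_at E x); exists x => //; split => //.
  exact: frame_atP.
have sub (a : frame E) : cimg al (fdom a) `<=` cimg al setT by move=> _ [x [ax _] <-]; exists x.
split.
  split; apply: smooth_local => p /cov[a ap]; exists (cimg al (fdom a)); split => //;
    by have [] := sq a.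
move=> p /cov[a ap] k; have [c1 c2 c3] := cimg_param ap.
transitivity (dzbar k (loc a) p).
  by apply: near_eq_dzbar; apply: filterS (near_open (oa a) ap) => q /qE ->.
rewrite (dzbar_sum _ _ (oa a) ap (s1 a)).
pose D := mdzbarX al k (psi al a j) (param al p).
pose M := psi al a j (param al p).
have -> : \sum_i dzbar k (fun q => \sum_l psi al a j (param al q) i l * psi al a j (param al q) l i) p
    = \tr (D *m M) + \tr (M *m D).
  rewrite -mxtraceD; apply: eq_bigr => i _.
  rewrite (dzbar_sum _ _ (oa a) ap (s2 a i)) !mxE -big_split; apply: eq_bigr => l _ /=.
  rewrite (dzbarM _ (oa a) (spsi al a j i l) (spsi al a j l i) ap).
  by rewrite !mxE c3.
have -> : D = - comm (conn01 A al a k (param al p)) M.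
  by apply/eqP; rewrite -addr_eq0; apply/eqP; exact: dpsi.
exact: trace_commutator.
Qed.

End QuadraticDifferential.
End Geometry.

(** * Convergence of the quadratic differentials *)

Lemma compact_bounded_above (R : realType) (T : topologicalType) (f : T -> R) (S : set T) :
  compact S -> (forall x, S x -> {for x, continuous f}) ->
  exists2 B, 0 <= B & forall x, S x -> f x <= B.
Proof.
move=> cS cf; have [S0|/set0P S0] := eqVneq S set0.
  by exists 0 => // x; rewrite S0.
have [|c _ cmax] := compact_EVT_max S0 cS (f := f).
  by apply: continuous_in_subspaceT => x /set_mem; exact: cf.
exists `|f c| => // x Sx; apply: le_trans (ler_norm _); apply: cmax; exact/mem_set.
Qed.

Section LimitDifferential.
Context {R : realType} (X : complex_surface R) (K : kahler_metric X).
Context (E : vector_bundle [set: X] 2) (h : hermitian_metric E).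
Context (A : nat -> connection_form E) (psi : nat -> form10 E).
Variable T : taubes_limit K h A psi.
Hypothesis psi_form : forall n, is_form10 (psi n).
Local Notation C := R[i].
Local Notation V := (C2 R).

Let fE x := frame_at E x.
Let fF x := frame_at (limit_bundle T) x.
Let fJ x := lframe_at (limit_line T) x.

Let pull n al x (j : 'I_2) : 'M[C]_2 :=
  pull_form10 (gauge (t := T) n) (psi (xi T n)) al (fE x) (fF x) j x.

Let limit_form al x (j : 'I_2) : 'M[C]_2 :=
  line_comp (tau (t := T)) (mu (t := T)) al (fJ x) (fF x) j x.

Let diff_norm n al x : R :=
  pnorm K (limit_metric T) al (fF x) x (fun j => pull n al x j - limit_form al x j).

Let trK al x : R := complex.Re (\tr (kmx K al x)).

Lemma gauge_unit n x : regular_set T x -> gauge (t := T) n (fE x) (fF x) x \in unitmx.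
Proof.
move=> rx; have [_ _ u _] := gaugeP T n.
by apply: u; [exact: frame_atP|exact: frame_atP].
Qed.

Lemma pull_norm n al x : regular_set T x -> cdom al x ->
  pnorm K (limit_metric T) al (fF x) x (pull n al x) = norm10 K h (psi (xi T n)) x.
Proof.
move=> rx ax; have aE : fdom (fE x) x by exact: frame_atP.
have aF : fdom (fF x) x by exact: frame_atP.
rewrite (norm10E K h (psi_form _) I ax aE).
have [_ _ _ iso] := gaugeP T n.
rewrite -[LHS]/(form_norm (kmx K al x) (limit_metric T (fF x) x) (pull n al x)).
rewrite -(iso _ _ _ aE aF).
exact: form_norm_conj (gauge_unit n rx) (positive_unit (hmx_positive h aE)).
Qed.

Lemma pull_trace n al j x : regular_set T x -> cdom al x ->
  \tr (pull n al x j *m pull n al x j) = qform (psi (xi T n)) al j x.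
Proof.
move=> rx ax; have ug := gauge_unit n rx.
by rewrite conjmxM // mxtrace_conj.
Qed.

(** The convergence [phi_C0] is measured in the chart [chart_at x], which varies with x; the
    estimates below are made in one fixed chart. *)
Lemma diff_norm_chart n al x : regular_set T x -> cdom al x ->
  diff_norm n al x = diff_norm n (chart_at x) x.
Proof.
move=> rx ax; have cx := chart_atP x.
have aE : fdom (fE x) x by exact: frame_atP.
have aJ : ldom (fJ x) x by exact: lframe_atP.
apply: (pnorm_chart K (limit_metric T) (fF x) cx ax) => j.
rewrite /pull /limit_form /pull_form10 /line_comp.
have [f1 _] := psi_form (xi T n); have [m1 _ _] := muP T.
rewrite (f1 _ _ (fE x) j x cx ax aE) (m1 _ _ (fJ x) j x cx ax aJ).
rewrite mulmx_sumr mulmx_suml scaler_suml -sumrB; apply: eq_bigr => m _.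
by rewrite -scalemxAr -scalemxAl scalerBr scalerA.
Qed.

(** For use on Z: there is no limit form there, but the norm of the form tends to 0. *)
Lemma qform_bound n al j x : cdom al x ->
  cmod (qform (psi (xi T n)) al j x) <=
    16 * trK al x * (norm10 K h (psi (xi T n)) x * norm10 K h (psi (xi T n)) x).
Proof.
move=> ax; have aE : fdom (fE x) x by exact: frame_atP.
rewrite (norm10E K h (psi_form _) I ax aE) /qform.
exact: (trace_le_form_norm _ _ _ _ (kmx_positive K ax) (hmx_positive h aE)).
Qed.

Lemma qform_diff_bound n al j x : regular_set T x -> cdom al x ->
  cmod (qform (psi (xi T n)) al j x - \tr (limit_form al x j *m limit_form al x j)) <=
    16 * trK al x * (diff_norm n al x * (2 * norm10 K h (psi (xi T n)) x + diff_norm n al x)).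
Proof.
move=> rx ax; rewrite -(pull_trace n j rx ax) -(pull_norm n rx ax).
have aF : fdom (fF x) x by exact: frame_atP.
have hK := kmx_positive K ax; have hh := hmx_positive (limit_metric T) aF.
pose D k := pull n al x k - limit_form al x k.
(* With D = P - L, the difference tr P^2 - tr L^2 is written in P and D only, so that no norm of the
   limit form L has to be controlled. *)
have -> : \tr (pull n al x j *m pull n al x j) - \tr (limit_form al x j *m limit_form al x j) =
   \tr (D j *m pull n al x j) + \tr (pull n al x j *m D j) - \tr (D j *m D j).
  have -> : limit_form al x j = pull n al x j - D j by rewrite /D opprB addrC subrK.
  move: (pull n al x j) (D j) => P Q.
  rewrite mulmxBl !mulmxBr !raddfB /=.
  by rewrite [RHS]addrC; move: (\tr _) (\tr _) (\tr _) (\tr _) => a b c d; ring.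
have b1 := trace_le_form_norm D (pull n al x) j j hK hh.
have b2 := trace_le_form_norm (pull n al x) D j j hK hh.
have b3 := trace_le_form_norm D D j j hK hh.
apply: le_trans (cmodD _ _) _; rewrite cmodN.
apply: (le_trans (lerD (le_trans (cmodD _ _) (lerD b1 b2)) b3)).
rewrite -/(trK al x) /diff_norm -/D.
rewrite -[pnorm _ _ _ _ _ D]/(form_norm (kmx K al x) (limit_metric T (fF x) x) D).
rewrite -[pnorm _ _ _ _ _ _]/(form_norm (kmx K al x) (limit_metric T (fF x) x) (pull n al x)).
move: (form_norm _ _ D) (form_norm _ _ (pull n al x)) (trK al x) => d N k.
by rewrite le_eqVlt; apply/orP; left; apply/eqP; ring.
Qed.

Lemma regularP x : ~ Theta T x -> ~ singular_set T x -> regular_set T x.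
Proof. by move=> nT nZ [|]. Qed.

(* Off [Theta] the value [0] is the actual limit; on [Theta] it is a junk value. *)
Definition qlim al j x : C :=
  if pselect (regular_set T x) then \tr (limit_form al x j *m limit_form al x j) else 0.

(** S may meet Z. Regular points and zeros of [phihat] are treated separately but with the same
    constant [M] and the same threshold, so the convergence is uniform across Z. *)
Lemma qform_uniform al j (S : set V) : compact S -> S `<=` cimg al (~` Theta T) ->
  forall e, 0 < e -> exists N, forall n, (N <= n)%N -> forall p, S p ->
    cmod (qform (psi (xi T n)) al j (param al p) - qlim al j (param al p)) <= e.
Proof.
move=> cS Ssub e e0.
have Sa p : S p -> [/\ cdom al (param al p), ~ Theta T (param al p) & coord al (param al p) = p].
  by move=> /Ssub/cimg_param.
have cpar p : S p -> {for p, continuous (param al)}.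
  by move=> /Sa[c1 _ c3]; rewrite -c3; exact: param_continuous.
have cS' : compact (param al @` S).
  apply: continuous_compact => //; apply: continuous_in_subspaceT => p /set_mem.
  exact: cpar.
have sub' : param al @` S `<=` ~` Theta T by move=> _ [p /Sa[_ + _] <-].
have [B B0 HB] : exists2 B, 0 <= B & forall x, (param al @` S) x -> phihat T x <= B.
  by apply: compact_bounded_above => // x /sub'; exact: phihat_continuous.
have [k k0 Hk] : exists2 k, 0 <= k & forall p, S p -> trK al (param al p) <= k.
  apply: compact_bounded_above => // p Sp.
  have Op : cimg al setT p by have [x [ax _] <-] := Ssub p Sp; exists x.
  rewrite /trK (_ : (fun x => complex.Re _) = fun q =>
    complex.Re (kmx K al (param al q) 0 0) + complex.Re (kmx K al (param al q) 1 1)).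
    by apply: continuousD; [exact: smooth_cont (kmx_smooth K al 0 0).1 Op
      |exact: smooth_cont (kmx_smooth K al 1 1).1 Op].
  apply/funext => q; rewrite /mxtrace !big_ord_recl big_ord0 addr0 ReD.
  by rewrite (_ : lift _ _ = 1) //; apply/val_inj.
(* As [eps] <= 1, the norms are at most B + 1 and the distance to the limit form at most 1, so [M]
   times [eps] dominates both bounds; k + 1 keeps [M] positive. *)
pose M := 16 * (k + 1) * (2 * (B + 1) + 1).
have M0 : 0 < M by rewrite !mulr_gt0 ?ltr_wpDl ?mulr_ge0 ?addr_ge0.
pose eps := Num.min 1 (e / M).
have eps0 : 0 < eps by rewrite lt_min ltr01 divr_gt0.
have eps1 : eps <= 1 by rewrite ge_min lexx.
have epsM : M * eps <= e.
  rewrite mulrC -ler_pdivlMr //; by rewrite ge_min lexx orbT.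
have [N1 _ H1] := phi_C0 cS' sub' eps0.
have [N2 _ H2] := phihat_C0 cS' sub' eps0.
exists (maxn N1 N2) => n; rewrite geq_max => /andP[n1 n2] p Sp.
have [ax nT _] := Sa p Sp.
have xS : (param al @` S) (param al p) by exists p.
have := H2 n n2 _ xS; have := H1 n n1 _ xS; have := HB _ xS; have := Hk p Sp.
move: ax nT; move: (param al p) => x ax nT {xS} kx Bx h1 h2.
have k0' : 0 <= trK al x.
  have [Q _ e'] := positive_hermitian_factor (kmx_positive K ax).
  by rewrite /trK e' mxtrace_mulC; exact: frob_ge0.
have norm0 : 0 <= norm10 K h (psi (xi T n)) x by exact: sqrtr_ge0.
rewrite /qlim; case: pselect => rx.
  have := h1 rx; rewrite -/(diff_norm n (chart_at x) x) -(diff_norm_chart n rx ax) => d1.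
  have d0 : 0 <= diff_norm n al x by exact: sqrtr_ge0.
  apply: le_trans (qform_diff_bound n j rx ax) _; apply: le_trans epsM.
  have nB : norm10 K h (psi (xi T n)) x <= B + 1.
    move: h2; rewrite ltr_norml => /andP[_]; rewrite ltrBlDr => /ltW h2.
    by apply: le_trans h2 _; rewrite addrC lerD.
  move: d0 d1 nB norm0 k0' kx; move: (diff_norm n al x) (norm10 _ _ _ _) (trK al x) => d N t.
  move=> d0 /ltW d1 nB n0 t0 tk.
  rewrite /M -[leRHS]mulrA; apply: ler_pM.
  - by rewrite mulr_ge0.
  - by rewrite mulr_ge0 // addr_ge0 // mulr_ge0.
  - by rewrite ler_wpM2l // (le_trans tk) // lerDl.
  - rewrite mulrC; apply: ler_pM => //; first by rewrite addr_ge0 // mulr_ge0.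
    by apply: lerD; [rewrite ler_wpM2l|exact: le_trans d1 eps1].
have p0 : phihat T x = 0.
  by apply: contrapT => nZ; apply: rx; exact: regularP.
rewrite subr0; apply: le_trans (qform_bound n j ax) _; apply: le_trans epsM.
move: h2; rewrite p0 subr0 ger0_norm //.
move: norm0 k0' kx; move: (norm10 _ _ _ _) (trK al x) => N t n0 t0 tk /ltW Ne.
rewrite /M -[leRHS]mulrA; apply: ler_pM.
- by rewrite mulr_ge0.
- by rewrite mulr_ge0.
- by rewrite ler_wpM2l // (le_trans tk) // lerDl.
- apply: ler_pM => //; apply: le_trans Ne _; apply: le_trans eps1 _.
  by rewrite lerDr mulr_ge0 // addr_ge0.
Qed.

(** If all coefficients vanished, so would mu and the limit form, since tr (tau^2) is minus the
    squared length of the frame of the line bundle. Then for a single large index the norm of the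
    form would be both below and above half of [phihat]. *)
Lemma qlim_regular al x : regular_set T x -> cdom al x -> exists j, qlim al j x <> 0.
Proof.
move=> rx ax; apply: contrapT => H.
have q0 j : qlim al j x = 0 by apply: contrapT => nq; apply: H; exists j.
have aJ : ldom (fJ x) x by exact: lframe_atP.
have aF : fdom (fF x) x by exact: frame_atP.
have [_ _ _ sk nm] := tauP T.
have t0 : \tr (tau (t := T) (fJ x) (fF x) x *m tau (t := T) (fJ x) (fF x) x) != 0.
  have := nm _ _ _ aJ aF; rewrite (sk _ _ _ aJ aF) mulmxN raddfN /= => /eqP.
  rewrite eqr_oppLR => /eqP ->; rewrite oppr_eq0 eq_complex /= negb_and gt_eqF //.
  exact: lnorm2_gt0.
have m0 j : limit_form al x j = 0.
  have := q0 j; rewrite /qlim; case: pselect => [? |/(_ rx)//].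
  rewrite /limit_form /line_comp -scalemxAl -scalemxAr scalerA mxtraceZ => /eqP.
  by rewrite mulf_eq0 (negbTE t0) orbF mulf_eq0 orbb => /eqP ->; rewrite scale0r.
have nT : ~ Theta T x by move=> tx; apply: rx; left.
have nZ : phihat T x != 0 by apply/eqP => z; apply: rx; right.
have p0 : 0 < phihat T x by rewrite lt_neqAle eq_sym nZ phihat_ge0.
have p2 : 0 < phihat T x / 2 by rewrite divr_gt0.
have sub : [set x] `<=` ~` Theta T by move=> y ->.
have [N1 _ H1] := phi_C0 (@compact_set1 _ x) sub p2.
have [N2 _ H2] := phihat_C0 (@compact_set1 _ x) sub p2.
pose n := maxn N1 N2.
have := H2 n (leq_maxr _ _) x erefl.
have := H1 n (leq_maxl _ _) x erefl rx.
rewrite -/(diff_norm n (chart_at x) x) -(diff_norm_chart n rx ax) /diff_norm.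
have -> : (fun j => pull n al x j - limit_form al x j) = pull n al x.
  by apply/funext => j; rewrite m0 subr0.
rewrite (pull_norm n rx ax); move: p0.
move: (norm10 _ _ _ _) (phihat T x) => a b b0 ab.
by rewrite ltr_norml => /andP[+ _]; lra.
Qed.

End LimitDifferential.

(** * From functions in a chart to functions on the surface *)

Section LocalEquations.
Context {R : realType} (X : complex_surface R).
Local Notation C := R[i].
Local Notation V := (C2 R).

Definition chart_preimage (al : chart X) (G : set V) : set X :=
  [set y | cdom al y /\ G (coord al y)].

Lemma chart_preimage_open al (G : set V) : open G -> open (chart_preimage al G).
Proof.
move=> oG; rewrite openE => y [ay Gy]; rewrite /interior.
have c1 : nbhs y (cdom al) by apply: open_nbhs_nbhs; split => //; exact: cdom_open.
have cc : coord al z @[z --> y] --> coord al y := coord_continuous ay.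
have c2 : \forall z \near y, G (coord al z).
  by apply: (cc G); exact: open_nbhs_nbhs.
exact: filterI c1 c2.
Qed.

(** Holomorphy on X is tested in every chart [be], so F is composed with the transition maps. *)
Lemma chart_holomorphicX al (G : set V) (F : V -> C) : open G -> holomorphic_on G F ->
  holomorphicX (chart_preimage al G) (fun y => F (coord al y)).
Proof.
move=> oG hF be; have oU := chart_preimage_open al oG.
apply: (@holomorphic_comp R G _ F (fun p => coord al (param be p)) oG (@cimg_open _ _ be _ oU) hF).
  by move=> p /cimg_param[_ [_ ?] _].
move=> j; apply: holomorphicW (transition_holomorphic al be j).
by move=> _ [y [by_ [ay _]] <-]; exists y.
Qed.

Lemma cube_interior (c : V) (r : R) p : `|p - c| < r -> nbhs p [set q : V | `|q - c| <= r].
Proof.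
move=> pr; apply/nbhs_normE; exists (r - `|p - c|) => [|q qp]; first by rewrite subr_gt0.
rewrite /= (le_trans (ler_distD p _ _)) // -lerBrDr ltW //.
Qed.

Lemma ball_open (c : V) (r : R) : open [set p : V | `|p - c| < r].
Proof.
rewrite openE => p /= pr; apply/nbhs_normE; exists (r - `|p - c|) => [|q qp].
  by rewrite subr_gt0.
by rewrite /= (le_lt_trans (ler_distD p _ _)) // -ltrBrDr.
Qed.

End LocalEquations.

(** * The limit differential near a point and its zero set *)

Section AnalyticZeroSet.
Context {R : realType} (X : complex_surface R) (K : kahler_metric X).
Context (E : vector_bundle [set: X] 2) (h : hermitian_metric E).
Context (A : nat -> connection_form E) (psi : nat -> form10 E).
Variable T : taubes_limit K h A psi.
Hypothesis psi_form : forall n, is_form10 (psi n).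
Hypothesis qform_hol : forall n al j,
  holomorphic_on (cimg al setT) (fun p => qform (psi n) al j (param al p)).
Local Notation C := R[i].
Local Notation V := (C2 R).

(* The cube may be centred at a bubbling point: only its boundary has to avoid
   [Theta], by the maximum principle. *)
Lemma qform_limit (x0 : X) : let al := chart_at x0 in
  exists r : R, exists F : 'I_2 -> V -> C,
  [/\ 0 < r, forall j, holomorphic_on [set p | `|p - coord al x0| < r] (F j) &
   forall x, cdom al x -> `|coord al x - coord al x0| < r -> x <> x0 ->
     ~ Theta T x /\ forall j, F j (coord al x) = qlim T al j x].
Proof.
move=> al; have ax0 : cdom al x0 by exact: chart_atP.
(* Only the bubbling points other than x0 are removed; finite sets are closed in a Hausdorff space,
   so this is a neighbourhood of x0 in all cases. *)
pose W0 : set X := ~` (Theta T `\ x0).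
have oW0 : open W0.
  rewrite openC; apply: compact_closed; first exact: cs_hausdorff.
  by apply: finite_compact; apply: finite_setD; exact: Theta_finite.
have W0x : W0 x0 by case=> _; apply.
set p0 := coord al x0.
have W0p : cimg al W0 p0 by exists x0.
have [r1 r10 H1] := (nbhs_normE _ _).1 (near_open (@cimg_open _ _ al _ oW0) W0p).
pose r := r1 / 2.
have r0 : 0 < r by rewrite divr_gt0.
have rr1 : r < r1 by rewrite ltr_pdivrMr // ltr_pMr // ltr1n.
pose Q := [set p : V | `|p - p0| <= r].
pose B := [set p : V | `|p - p0| = r].
pose G := [set p : V | `|p - p0| < r].
have oG : open G by exact: ball_open.
have oO : open (cimg al setT) by apply: cimg_open; exact: openT.
have QW p : Q p -> cimg al W0 p by move=> Qp; apply: H1; exact: le_lt_trans rr1.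
have QO : Q `<=` cimg al setT.
  by move=> p /QW[x [ax _] <-]; exists x.
have cQ : compact Q by exact: compact_cube.
have Qint p : Q p -> ~ B p -> nbhs p Q.
  move=> Qp nB; apply: cube_interior; rewrite lt_neqAle Qp andbT; exact/eqP.
have noT p : Q p -> p <> p0 -> cimg al (~` Theta T) p.
  move=> /QW[x [ax Wx] <-] xp; exists x => //; split => // Tx; apply: Wx; split => //.
  by move=> e; apply: xp; rewrite e.
have cQB : compact (Q `&` B).
  apply: (@subclosed_compact _ (Q `&` B) Q _ cQ); last by move=> p [].
  apply: closedI; first by apply: compact_closed => //; exact: norm_hausdorff.
  rewrite (_ : B = (fun p => `|p - p0|) @^-1` [set r]); last by apply/seteqP; split.
  apply: preimage_closed; last exact: closed_eq.
  move=> p _; apply: cvg_norm; apply: cvgB; [exact: cvg_id|exact: cvg_cst].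
have QBT : Q `&` B `<=` cimg al (~` Theta T).
  move=> p [Qp Bp]; apply: noT => // e; move: Bp; rewrite /B e /= subrr normr0 => e0.
  by move: r0; rewrite -e0 ltxx.
pose q n j p := qform (psi (xi T n)) al j (param al p).
(* [part] stands for the real or the imaginary part. On the boundary of the cube two members of the
   sequence are compared through their common uniform limit [qlim]. *)
have uni (part : C -> R) j : (forall a b, part (a - b) = part a - part b) ->
    (forall a, `|part a| <= cmod a) -> ucauchy (Q `&` B) (fun n p => part (q n j p)).
  move=> pB pC e e0; have e2 : 0 < e / 2 by rewrite divr_gt0.
  have [N HN] := qform_uniform psi_form j cQB QBT e2.
  exists N => n m nN mN p Sp; rewrite -pB.
  apply: le_trans (pC _) _.
  have -> : q n j p - q m j p = (q n j p - qlim T al j (param al p)) +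
      (qlim T al j (param al p) - q m j p) by rewrite addrA subrK.
  apply: le_trans (cmodD _ _) _; rewrite (splitr e) lerD //; first exact: HN.
  by rewrite cmodB; exact: HN.
have ReB (a b : C) : complex.Re (a - b) = complex.Re a - complex.Re b.
  by case: a b => [? ?] [].
have ImB (a b : C) : complex.Im (a - b) = complex.Im a - complex.Im b.
  by case: a b => [? ?] [].
have qh n j : holomorphic_on (cimg al setT) (q n j) by exact: qform_hol.
have uR j : ucauchy Q (fun n p => complex.Re (q n j p)).
  apply: (ucauchy_boundary oO QO cQ Qint) => [n|]; last exact: uni ReB (@Re_le_cmod R).
  exact: (holomorphic_harmonic oO (qh n j)).1.
have uI j : ucauchy Q (fun n p => complex.Im (q n j p)).
  apply: (ucauchy_boundary oO QO cQ Qint) => [n|]; last exact: uni ImB (@Im_le_cmod R).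
  exact: (holomorphic_harmonic oO (qh n j)).2.
have GQ : G `<=` Q by move=> p; exact: ltW.
have lu (hs : nat -> V -> R) : ucauchy Q hs -> lucauchy G hs.
  move=> u p Gp; have [s s0 Hs] := (nbhs_normE _ _).1 (near_open oG Gp).
  by exists s => //; apply: ucauchyW u => x /Hs /GQ.
(* [lim] is a default value where the sequence diverges; [F] is used only inside the cube, where the
   sequence is Cauchy. *)
pose F j p : C := Complex (lim (complex.Re (q n j p) @[n --> \oo]))
                          (lim (complex.Im (q n j p) @[n --> \oo])).
have FR j p : G p -> complex.Re (q n j p) @[n --> \oo] --> complex.Re (F j p).
  by move=> /GQ Qp; exact: cauchy_pointwise (uR j) Qp.
have FI j p : G p -> complex.Im (q n j p) @[n --> \oo] --> complex.Im (F j p).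
  by move=> /GQ Qp; exact: cauchy_pointwise (uI j) Qp.
exists r, F; split => // [j|x ax xr xx0].
  apply: (holomorphic_limit oG (fun n => holomorphicW (subset_trans GQ QO) (qh n j))).
  - exact: lu (uR j).
  - exact: lu (uI j).
  - exact: FR.
  - exact: FI.
have xp0 : coord al x <> p0.
  by move=> e; apply: xx0; rewrite -(coordK ax) e coordK.
have xT := noT _ (GQ _ xr) xp0.
have nT : ~ Theta T x by have [_ + _] := cimg_param xT; rewrite coordK.
split => // j.
have sx : [set coord al x] `<=` cimg al (~` Theta T) by move=> p ->.
have lim_q (part : C -> R) : (forall a b, part (a - b) = part a - part b) ->
    (forall a, `|part a| <= cmod a) ->
    part (q n j (coord al x)) @[n --> \oo] --> part (qlim T al j x).
  move=> pB pC; apply/cvgrPdist_le => e e0.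
  have [N HN] := qform_uniform psi_form j (@compact_set1 _ (coord al x)) sx e0.
  exists N => // n /= Nn; rewrite distrC -pB; apply: le_trans (pC _) _.
  by rewrite /q; have := HN n Nn _ erefl; rewrite (coordK ax).
have e1 := cvg_unique _ (FR j _ xr) (lim_q _ ReB (@Re_le_cmod R)).
have e2 := cvg_unique _ (FI j _ xr) (lim_q _ ImB (@Im_le_cmod R)).
apply/eqP; rewrite eq_complex; apply/andP; split; apply/eqP; [exact: e1|exact: e2].
Qed.

(* If [x0] is a zero of [phihat], the singular set near [x0] is [{x0}] together
   with the zeros of the limits [F j]: at a bubbling point [F] need not vanish, so
   the equations are [F j * (z_i - z_i x0) = 0]. *)
Lemma taubes_singular_set_analytic : analytic_subvariety (singular_set T).
Proof.
move=> x0; have [Zx0|nZ] := pselect (singular_set T x0); last first.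
  (* Near a point off Z the single equation 1 = 0 describes the empty set. *)
  exists (~` singular_set T); split => //.
    by rewrite openC; exact: singular_closed.
  exists 1%N, (fun _ _ => 1); split=> [_ al|y nZy]; first exact: holomorphic_cst.
  split=> [//|/(_ ord0) /eqP]; by rewrite oner_eq0.
have [r [F [r0 hF FE]]] := qform_limit x0.
set al := chart_at x0 in hF FE; have ax0 : cdom al x0 by exact: chart_atP.
set p0 := coord al x0 in hF FE; set G := [set p | _] in hF.
have oG : open G by exact: ball_open.
pose F' (ji : 'I_2 * 'I_2) p := F ji.1 p * (zcoord ji.2 p - zcoord ji.2 p0).
have hF' ji : holomorphic_on G (F' ji).
  exact: (holomorphicM oG (hF _) (holomorphic_zcoord_sub _ _ oG)).
exists (chart_preimage al G); split; first exact: chart_preimage_open.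
  by split => //; rewrite /G /= subrr normr0.
exists #|{: 'I_2 * 'I_2}|, (fun i y => F' (enum_val i) (coord al y)).
split=> [i|y [ay Gy]]; first exact: chart_holomorphicX.
have [->|yx] := pselect (y = x0).
  by split=> // _ i; rewrite /F' subrr mulr0.
have [nT Fq] := FE y ay Gy yx.
split=> [Zy i|H].
  rewrite /F' Fq /qlim; case: pselect => [ry|nr]; last by rewrite mul0r.
  by exfalso; apply: ry; right.
apply: contrapT => nZy.
(* One nonzero F j turns the equations F j * (z_i - z_i x0) = 0 into equality of both coordinates,
   which would force y = x0. *)
have [j qj] := qlim_regular psi_form (regularP nT nZy) ay.
apply: yx; rewrite -(coordK ay) -(coordK ax0); congr param.
have zi i : zcoord i (coord al y) = zcoord i p0.
  have := H (enum_rank (j, i)); rewrite enum_rankK /F' /= Fq => /eqP.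
  rewrite mulf_eq0 => /orP[/eqP//|]; by rewrite subr_eq0 => /eqP.
apply/eqP; rewrite -subr_eq0 -normr_le0; apply: norm_le_rcoord => -[i b].
by rewrite rcoordB /rcoord /= zi subrr normr0.
Qed.

End AnalyticZeroSet.

Lemma scale_form10P (R : realType) (X : complex_surface R) (W : set X) r
    (E : vector_bundle W r) (c : R) (phi : form10 E) :
  is_form10 phi -> is_form10 (scale_form10 c phi).
Proof.
move=> [f1 f2]; split=> [al be a j x ax bx aa|al a b j x ax aa bb].
  rewrite /scale_form10 (f1 al be a j x ax bx aa) scaler_sumr; apply: eq_bigr => m _.
  by rewrite !scalerA mulrC.
by rewrite /scale_form10 (f2 al a b j x ax aa bb) -scalemxAr -scalemxAl.
Qed.

Lemma qform_scale (R : realType) (X : complex_surface R) (E : vector_bundle [set: X] 2)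
    (c : R) (phi : form10 E) al j x :
  qform (scale_form10 c phi) al j x = c%:C%C * c%:C%C * qform phi al j x.
Proof. by rewrite /qform /scale_form10 -scalemxAl -scalemxAr scalerA mxtraceZ. Qed.

Theorem theorem1p2 (R : realType) (X : complex_surface R)
    (X_compact : compact [set: X]) (K : kahler_metric X)
    (E : vector_bundle [set: X] 2) (h : hermitian_metric E)
    (E_c1 : c1_eq0 E)
    (A : nat -> connection_form E) (phi : nat -> form10 E)
    (A_connection : forall n, is_connection (A n))
    (A_smooth : forall n, smooth_connection (A n))
    (A_unitary : forall n, unitary_connection h (A n))
    (phi_form : forall n, is_form10 (phi n))
    (phi_smooth : forall n, smooth_form10 (phi n))
    (A_phi_simpson : forall n, simpson K h (A n) (phi n))
    (r_gt0 : forall n, 0 < L2norm10 K h (phi n))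
    (r_unbounded : forall s : nat -> nat, {homo s : m n / (m < n)%N} ->
       ~ exists M : R, forall n, L2norm10 K h (phi (s n)) <= M)
    (T : taubes_limit K h A
           (fun n => scale_form10 (L2norm10 K h (phi n))^-1 (phi n))) :
  analytic_subvariety (singular_set T).
Proof.
apply: taubes_singular_set_analytic => [n|n al j]; first exact: scale_form10P.
set c := (L2norm10 K h (phi n))^-1.
(* Simpson's equations hold for the forms before normalisation; the normalisation only multiplies
   the quadratic differential by the constant c^2. *)
have -> : (fun p => qform (scale_form10 c (phi n)) al j (param al p)) =
    fun p => c%:C%C * c%:C%C * qform (phi n) al j (param al p).
  by apply/funext => p; exact: qform_scale.
have oO : open (cimg al [set: X]) by apply: cimg_open; exact: openT.
apply: holomorphicM => //; first exact: holomorphic_cst.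
apply: (qform_holomorphic (A := A n) (phi_form n) (phi_smooth n)) => a x ax aa k.
by have [] := A_phi_simpson n al a x ax aa.
Qed.
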